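(* There exists an algorithm which, given as input a finite set $\mathcal{L}$ of $n$ equilateral $l$'s (each specified by the coordinates of its corner and the endpoints of its two arms), runs in $O(n(\log n)^2)$ time and outputs an independent set $I\subseteq\mathcal{L}$ of the intersection graph of $\mathcal{L}$ with $|I|\ \ge\ \alpha/(36\log(2d))$, where $\alpha$ is the maximum size of an independent set of that intersection graph, $d=d(\mathcal{L})=d_{max}(\mathcal{L})/d_{min}(\mathcal{L})$, and $\log$ is to base 2.
   Context: An $l$ is a planar object which is the union of a horizontal and a vertical line segment (its two arms) of positive length sharing a common endpoint (its corner), in one of the four shapes $\llcorner$, $\ulcorner$, $\urcorner$, $\lrcorner$; e.g. an $l$ of shape $\llcorner$ with corner $(x_c,y_c)$ is the point set $\{(x,y_c): x_c\le x\le x_h\}\cup\{(x_c,y): y_c\le y\le y_v\}$ with $x_h>x_c$, $y_v>y_c$, and the other shapes are its rotations. An $l$ is equilateral if its horizontal and vertical arms have the same length, denoted $le(l)$. For a set $\mathcal{L}$ of equilateral $l$'s, $d_{max}(\mathcal{L})$ and $d_{min}(\mathcal{L})$ are the maximum and minimum of $le(l)$ over $l\in\mathcal{L}$. Two distinct $l$'s intersect if their point sets have a common point; the intersection graph of $\mathcal{L}$ has vertex set $\mathcal{L}$ and an edge between every intersecting pair (such graphs are the equilateral $B_1$-VPG graphs). An independent set is a subset of $\mathcal{L}$ no two members of which intersect. *)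

(* Defs.v *)
From HB Require Import structures.
From mathcomp Require Import all_boot all_order all_algebra.
From mathcomp Require Import all_classical all_reals all_analysis.
Set Implicit Arguments.
Unset Strict Implicit.
Unset Printing Implicit Defensive.
Import Order.TTheory GRing.Theory Num.Theory.
Import numFieldNormedType.Exports.
Local Open Scope classical_set_scope.
Local Open Scope ring_scope.

Definition log2 (R : realType) (x : R) : R := ln x / ln 2.

(** * l's *)

(* The l with corner (xc, yc), horizontal arm ending at (xh, yc) and vertical
   arm ending at (xc, yv).  The signs of xh - xc and yv - yc give the four
   shapes. *)
Record ell (R : realType) := Ell {
  xc : R; yc : R; xh : R; yv : R;
  ell_hpos : xc != xh;
  ell_vpos : yc != yv }.

Definition points (R : realType) (l : ell R) : set (R * R) :=
  [set p | Num.min (xc l) (xh l) <= p.1 <= Num.max (xc l) (xh l)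
           /\ p.2 = yc l] `|`
  [set p | p.1 = xc l
           /\ Num.min (yc l) (yv l) <= p.2 <= Num.max (yc l) (yv l)].

Definition hlength (R : realType) (l : ell R) : R := `|xh l - xc l|.
Definition vlength (R : realType) (l : ell R) : R := `|yv l - yc l|.

Definition equilateral (R : realType) (l : ell R) : Prop :=
  hlength l = vlength l.

(* Meaningful for equilateral l's. *)
Definition elength (R : realType) (l : ell R) : R := hlength l.

(* A set of n l's is given as an injective family indexed by 'I_n; its subsets
   are then the sets of indices. *)

Definition dmax (R : realType) (n : nat) (L : 'I_n -> ell R) : R :=
  \big[Num.max/0]_(i < n) elength (L i).

(* Starting the iterated minimum at dmax gives the true minimum for n > 0. *)
Definition dmin (R : realType) (n : nat) (L : 'I_n -> ell R) : R :=
  \big[Num.min/dmax L]_(i < n) elength (L i).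

Definition dratio (R : realType) (n : nat) (L : 'I_n -> ell R) : R :=
  dmax L / dmin L.

Definition intersection_graph (R : realType) (n : nat) (L : 'I_n -> ell R) :
  rel 'I_n :=
  fun i j => (i != j) && `[< points (L i) `&` points (L j) !=set0 >].

Definition independent (T : finType) (e : rel T) (I : {set T}) : bool :=
  [forall i in I, forall j in I, ~~ e i j].

Definition alpha (T : finType) (e : rel T) : nat :=
  \max_(I : {set T} | independent e I) #|I|.

(** * Real RAM *)

(* Programs of a real RAM, in structured form, at unit cost per operation.
   The memory consists of numbered arrays of natural numbers and numbered
   arrays of reals, all of unbounded length; the array used by an instruction
   is fixed by the program, the cell is computed.
   - Integer operations are addition, truncated subtraction and halving.
     Multiplication is left out, as unit-cost multiplication of unbounded
     integers is not a realistic primitive.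
   - Real operations are the four field operations (x / 0 being 0) and
     comparison.  There is no floor nor any other way of turning a real into
     an integer, except by branching on comparisons.
   - Constants are natural numbers, so a program cannot carry a real number
     encoding extra information.
   A program is thus a finite object which does not depend on the input
   size. *)
Inductive iexp : Type :=
  | INum of nat
  | IGet of nat & iexp
  | IAdd of iexp & iexp
  | ISub of iexp & iexp
  | IHalf of iexp.

Inductive rexp : Type :=
  | RNum of nat
  | RGet of nat & iexp
  | RAdd of rexp & rexp
  | RSub of rexp & rexp
  | RMul of rexp & rexp
  | RDiv of rexp & rexp.

Inductive bexp : Type :=
  | BILe of iexp & iexp
  | BRLe of rexp & rexp
  | BNot of bexp
  | BAnd of bexp & bexp.

(* ISet a e1 e2 is a[e1] := e2 in the integer array number a; RSet likewise. *)
Inductive cmd : Type :=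
  | Skip
  | ISet of nat & iexp & iexp
  | RSet of nat & iexp & rexp
  | Seq of cmd & cmd
  | If of bexp & cmd & cmd
  | While of bexp & cmd.

Record state (R : realType) := State {
  imem : nat -> nat -> nat;
  rmem : nat -> nat -> R }.

Definition upd (V : Type) (m : nat -> nat -> V) (a i : nat) (v : V) :
  nat -> nat -> V :=
  fun b j => if (b == a) && (j == i) then v else m b j.

Definition iupd (R : realType) (s : state R) (a i : nat) (v : nat) : state R :=
  State (upd (imem s) a i v) (rmem s).

Definition rupd (R : realType) (s : state R) (a i : nat) (v : R) : state R :=
  State (imem s) (upd (rmem s) a i v).

Fixpoint ieval (R : realType) (s : state R) (e : iexp) : nat :=
  match e with
  | INum k => k
  | IGet a e => imem s a (ieval s e)
  | IAdd e1 e2 => (ieval s e1 + ieval s e2)%N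
  | ISub e1 e2 => (ieval s e1 - ieval s e2)%N
  | IHalf e => (ieval s e)./2
  end.

Fixpoint reval (R : realType) (s : state R) (e : rexp) : R :=
  match e with
  | RNum k => k%:R
  | RGet a e => rmem s a (ieval s e)
  | RAdd e1 e2 => reval s e1 + reval s e2
  | RSub e1 e2 => reval s e1 - reval s e2
  | RMul e1 e2 => reval s e1 * reval s e2
  | RDiv e1 e2 => reval s e1 / reval s e2
  end.

Fixpoint beval (R : realType) (s : state R) (b : bexp) : bool :=
  match b with
  | BILe e1 e2 => (ieval s e1 <= ieval s e2)%N
  | BRLe e1 e2 => reval s e1 <= reval s e2
  | BNot b => ~~ beval s b
  | BAnd b1 b2 => beval s b1 && beval s b2
  end.

Fixpoint icost (e : iexp) : nat :=
  match e with
  | INum _ => 1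
  | IGet _ e => (icost e).+1
  | IAdd e1 e2 => (icost e1 + icost e2).+1
  | ISub e1 e2 => (icost e1 + icost e2).+1
  | IHalf e => (icost e).+1
  end.

Fixpoint rcost (e : rexp) : nat :=
  match e with
  | RNum _ => 1
  | RGet _ e => (icost e).+1
  | RAdd e1 e2 => (rcost e1 + rcost e2).+1
  | RSub e1 e2 => (rcost e1 + rcost e2).+1
  | RMul e1 e2 => (rcost e1 + rcost e2).+1
  | RDiv e1 e2 => (rcost e1 + rcost e2).+1
  end.

Fixpoint bcost (b : bexp) : nat :=
  match b with
  | BILe e1 e2 => (icost e1 + icost e2).+1
  | BRLe e1 e2 => (rcost e1 + rcost e2).+1
  | BNot b => (bcost b).+1
  | BAnd b1 b2 => (bcost b1 + bcost b2).+1
  end.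

(* exec c s t s': started in s, the program c halts in s' after t steps. *)
Inductive exec (R : realType) : cmd -> state R -> nat -> state R -> Prop :=
  | ExecSkip s : exec Skip s 1 s
  | ExecISet a e1 e2 s :
      exec (ISet a e1 e2) s (icost e1 + icost e2).+1
           (iupd s a (ieval s e1) (ieval s e2))
  | ExecRSet a e1 e2 s :
      exec (RSet a e1 e2) s (icost e1 + rcost e2).+1
           (rupd s a (ieval s e1) (reval s e2))
  | ExecSeq c1 c2 s1 t1 s2 t2 s3 :
      exec c1 s1 t1 s2 -> exec c2 s2 t2 s3 ->
      exec (Seq c1 c2) s1 (t1 + t2)%N s3
  | ExecIf b c1 c2 s t s' :
      exec (if beval s b then c1 else c2) s t s' ->
      exec (If b c1 c2) s (bcost b + t).+1 s'
  | ExecWhileFalse b c s :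
      beval s b = false ->
      exec (While b c) s (bcost b).+1 s
  | ExecWhileTrue b c s1 t1 s2 t2 s3 :
      beval s1 b = true ->
      exec c s1 t1 s2 -> exec (While b c) s2 t2 s3 ->
      exec (While b c) s1 (bcost b + t1 + t2).+1 s3.

Lemma exec_det (R : realType) (c : cmd) (s s1 s2 : state R) (t1 t2 : nat) :
  exec c s t1 s1 -> exec c s t2 s2 -> t1 = t2 /\ s1 = s2.
Proof.
move=> H; elim: H t2 s2 => {c s t1 s1}.
- by move=> s t2 s2 H; inversion H.
- by move=> a e1 e2 s t2 s2 H; inversion H.
- by move=> a e1 e2 s t2 s2 H; inversion H.
- move=> c1 c2 s1 t1 s2 t2 s3 _ IH1 _ IH2 t s H; inversion H; subst.
  have [? ?] := IH1 _ _ ltac:(eassumption); subst.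
  by have [? ?] := IH2 _ _ ltac:(eassumption); subst.
- move=> b c1 c2 s t s' _ IH t2 s2 H; inversion H; subst.
  by have [? ?] := IH _ _ ltac:(eassumption); subst.
- by move=> b c s hb t2 s2 H; inversion H; subst => //; congruence.
- move=> b c s1 t1 s2 t2 s3 hb _ IH1 _ IH2 t s H; inversion H; subst.
    by congruence.
  have [? ?] := IH1 _ _ ltac:(eassumption); subst.
  by have [? ?] := IH2 _ _ ltac:(eassumption); subst.
Qed.

(** * Input and output *)

Definition of_family (V : Type) (v0 : V) (n : nat) (f : 'I_n -> V) (i : nat) :
  V := if insub i is Some j then f j else v0.

(* Cell 0 of the integer array 0 holds n.  Cells i < n of the real arrays
   0, ..., 5 hold the coordinates of the corner, of the endpoint of the
   horizontal arm and of the endpoint of the vertical arm of the i-th l.  All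
   the other cells hold 0. *)
Definition input (R : realType) (n : nat) (L : 'I_n -> ell R) : state R :=
  State
    (fun a i => if (a == 0%N) && (i == 0%N) then n else 0%N)
    (nth (fun=> 0)
       [:: of_family 0 (fun i => xc (L i)); of_family 0 (fun i => yc (L i));
           of_family 0 (fun i => xh (L i)); of_family 0 (fun i => yc (L i));
           of_family 0 (fun i => xc (L i)); of_family 0 (fun i => yv (L i))]).

(* The output is read off the integer array 1, as a characteristic vector. *)
Definition output (R : realType) (n : nat) (s : state R) : {set 'I_n} :=
  [set i : 'I_n | imem s 1 i != 0%N].

(* Main.v *)
(** Reflecting each l according to its shape, all corners may be assumed to lie
at the bottom left.  Sorting by length and cutting greedily, without any
rounding, splits the l's into groups whose lengths lie in an interval [w, 2w);
at most log (2 d) groups arise, as their starting lengths double.  The l's of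
one group and shape are cut in the same way into columns of width w by the
abscissa of the corner, and each column into cells of height w by the ordinate.
Two l's in a common cell are disjoint exactly if one corner lies strictly above
and to the right of the other.  Two l's of the same group and shape, in
different cells whose column numbers agree modulo 3 and whose cell numbers agree
modulo 3, are always disjoint.

Order the l's by cell number and, within a cell, by strict domination of
corners.  Every independent set is a chain, so a single longest increasing
subsequence over all the l's has at least alpha elements.  There are at most
4 * 9 * log (2 d) classes (shape, group, residues modulo 3), and the elements of
the chain in one class are independent, so the most frequent class on the chain
is an independent set of the required size.

The time is dominated by four sorts, by a tournament tree, and by the binary
searches of patience sorting. *)

Require Import Defs.
From mathcomp Require Import all_boot all_order all_algebra.
From mathcomp Require Import all_classical all_reals all_analysis.
From mathcomp Require Import zify ring lra.
Set Implicit Arguments.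
Unset Strict Implicit.
Unset Printing Implicit Defensive.
Import Order.TTheory GRing.Theory Num.Theory.
Import numFieldNormedType.Exports.
Local Open Scope classical_set_scope.
Local Open Scope ring_scope.

(** * Cost-aware program logic *)

Section Logic.
Variable R : realType.
Implicit Types (s : state R) (c : cmd) (b : bexp).

(** A total-correctness triple: [t] only bounds the number of steps, so costs may be rounded up at
    every stage. *)
Definition runs c s (t : nat) (Q : state R -> Prop) : Prop :=
  exists t' s', [/\ exec c s t' s', (t' <= t)%N & Q s'].

Lemma runs_conseq c s t t' (Q Q' : state R -> Prop) :
  runs c s t Q -> (t <= t')%N -> (forall s', Q s' -> Q' s') -> runs c s t' Q'.
Proof.
by case=> [u [s' [h1 h2 h3]]] h4 h5; exists u, s'; split; auto; apply: leq_trans h4.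
Qed.

Lemma runs_le t c s t' Q : runs c s t Q -> (t <= t')%N -> runs c s t' Q.
Proof. by move=> h1 h2; exact: (runs_conseq h1 h2). Qed.

Lemma runs_seq c1 c2 s t1 t2 Q :
  runs c1 s t1 (fun s' => runs c2 s' t2 Q) -> runs (Seq c1 c2) s (t1 + t2)%N Q.
Proof.
case=> [u1 [s1 [h1 h2 [u2 [s2 [h3 h4 h5]]]]]].
exists (u1 + u2)%N, s2; split => //; first exact: ExecSeq h1 h3.
exact: leq_add.
Qed.

Fixpoint iwrites c : seq nat :=
  match c with
  | ISet a _ _ => [:: a]
  | Seq c1 c2 | If _ c1 c2 => iwrites c1 ++ iwrites c2
  | While _ c => iwrites c
  | _ => [::]
  end.

Fixpoint rwrites c : seq nat :=
  match c with
  | RSet a _ _ => [:: a]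
  | Seq c1 c2 | If _ c1 c2 => rwrites c1 ++ rwrites c2
  | While _ c => rwrites c
  | _ => [::]
  end.

(** The frame rule at the granularity of whole arrays: whether an array survives a command is
    decided by computing its list of written arrays. *)
Definition same c s s' : Prop :=
  (forall a, a \notin iwrites c -> imem s' a = imem s a) /\
  (forall a, a \notin rwrites c -> rmem s' a = rmem s a).

Lemma same_refl c s : same c s s.
Proof. by []. Qed.

Lemma same_trans c s1 s2 s3 : same c s1 s2 -> same c s2 s3 -> same c s1 s3.
Proof.
move=> [h1 h2] [h3 h4]; split=> a ha; first by rewrite h3 ?h1.
by rewrite h4 ?h2.
Qed.

Lemma upd_other (V : Type) (m : nat -> nat -> V) (a i : nat) (v : V) (a2 : nat) :
  a2 != a -> upd m a i v a2 = m a2.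
Proof. by move=> /negbTE h; apply/funext => j; rewrite /upd h. Qed.

Lemma exec_same c s t s' : exec c s t s' -> same c s s'.
Proof.
elim=> {c s t s'} [||||b c1 c2 s t s' _ [h1 h2]|//|b c s1 t1 s2 t2 s3 _ _ h1 _ h2].
- by [].
- by move=> a e1 e2 s; split=> //= k; rewrite inE => hk; rewrite upd_other.
- by move=> a e1 e2 s; split=> //= k; rewrite inE => hk; rewrite upd_other.
- move=> c1 c2 s1 t1 s2 t2 s3 _ [h1 h2] _ [h3 h4]; split=> a /=.
    by rewrite mem_cat negb_or => /andP[ha hb]; rewrite h3 ?h1.
  by rewrite mem_cat negb_or => /andP[ha hb]; rewrite h4 ?h2.
- split=> a /=; rewrite mem_cat negb_or => /andP[ha hb].
    by apply: h1; case: ifP.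
  by apply: h2; case: ifP.
- exact: same_trans h1 h2.
Qed.

Lemma runs_same c s t Q :
  runs c s t Q -> runs c s t (fun s' => Q s' /\ same c s s').
Proof.
by case=> [u [s' [h1 h2 h3]]]; exists u, s'; split=> //; split=> //; exact: exec_same h1.
Qed.

(** The index [m] of the invariant is a variant that drops by one per iteration; it bounds the
    iterations left, and the loop may stop early. The hypothesis [same c s0 s] makes all frame facts
    available in the body without putting them into [I]. *)
Lemma runs_while b c s0 B (I : nat -> state R -> Prop) (Q : state R -> Prop) :
  (forall m s, same c s0 s -> I m s -> beval s b ->
     (0 < m)%N /\ runs c s B (I m.-1)) ->
  (forall m s, same c s0 s -> I m s -> ~~ beval s b -> Q s) ->
  forall m, I m s0 ->
  runs (While b c) s0 (m * (B + bcost b).+1 + (bcost b).+1)%N Q.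
Proof.
move=> hT hF m; have := same_refl c s0; move: {2 3 4}s0 => s.
elim: m s => [|m IH] s hs hI.
  case hb: (beval s b); first by have [] := hT _ _ hs hI hb.
  exists (bcost b).+1, s; split; [exact: ExecWhileFalse|lia|].
  by apply: hF hI _ => //; rewrite hb.
case hb: (beval s b); last first.
  exists (bcost b).+1, s; split; [exact: ExecWhileFalse|lia|].
  by apply: hF hI _ => //; rewrite hb.
have [_ /runs_same[t1 [s1 [h1 h2 [h3 h3']]]]] := hT _ _ hs hI hb.
have [t2 [s2 [h4 h5 h6]]] := IH s1 (same_trans hs h3') h3.
exists (bcost b + t1 + t2).+1, s2; split => //; first exact: ExecWhileTrue h1 h4.
lia.
Qed.

Fixpoint loopfree c : bool :=
  match c with
  | Seq c1 c2 | If _ c1 c2 => loopfree c1 && loopfree c2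
  | While _ _ => false
  | _ => true
  end.

(** The final state of a loop-free command as a function, so that straight-line code is verified by
    simplification. The value on [While] is a dummy. *)
Fixpoint sem c s : state R :=
  match c with
  | ISet a e1 e2 => iupd s a (ieval s e1) (ieval s e2)
  | RSet a e1 e2 => rupd s a (ieval s e1) (reval s e2)
  | Seq c1 c2 => sem c2 (sem c1 s)
  | If b c1 c2 => if beval s b then sem c1 s else sem c2 s
  | _ => s
  end.

(** An upper bound independent of the state: a conditional is charged for both branches. *)
Fixpoint cost c : nat :=
  match c with
  | ISet a e1 e2 => (icost e1 + icost e2).+1
  | RSet a e1 e2 => (icost e1 + rcost e2).+1
  | Seq c1 c2 => cost c1 + cost c2
  | If b c1 c2 => (bcost b + (cost c1 + cost c2)).+1
  | _ => 1
  end.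

Lemma exec_sem c s : loopfree c -> exists2 t, exec c s t (sem c s) & (t <= cost c)%N.
Proof.
elim: c s => [|a e1 e2|a e1 e2|c1 IH1 c2 IH2|b c1 IH1 c2 IH2|//] s /=.
- by exists 1%N => //; constructor.
- by eexists; first exact: ExecISet.
- by eexists; first exact: ExecRSet.
- move=> /andP[/IH1-/(_ s)[t1 h1 h1'] /IH2-/(_ (sem c1 s))[t2 h2 h2']].
  by exists (t1 + t2)%N; [exact: ExecSeq h1 h2|exact: leq_add].
- move=> /andP[/IH1-/(_ s)[t1 h1 h1'] /IH2-/(_ s)[t2 h2 h2']].
  case hb: (beval s b).
    exists (bcost b + t1).+1; last lia.
    by apply: ExecIf; rewrite hb.
  exists (bcost b + t2).+1; last lia.
  by apply: ExecIf; rewrite hb.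
Qed.

Lemma sem_same c s : loopfree c -> same c s (sem c s).
Proof. by move=> /(exec_sem s)[t /exec_same]. Qed.

Lemma runs_sem c s (Q : state R -> Prop) :
  loopfree c -> Q (sem c s) -> runs c s (cost c) Q.
Proof. by move=> /(exec_sem s)[t h1 h2] hQ; exists t, (sem c s). Qed.

Lemma runs_sem_le c s B (Q : state R -> Prop) :
  loopfree c -> (cost c <= B)%N -> Q (sem c s) -> runs c s B Q.
Proof. by move=> h1 h2 h3; apply: (runs_conseq (runs_sem h1 h3)). Qed.

Lemma runs_sem_seq c1 c2 s t Q :
  loopfree c1 -> runs c2 (sem c1 s) t Q -> runs (Seq c1 c2) s (cost c1 + t)%N Q.
Proof. by move=> h1 h2; apply: runs_seq; apply: runs_sem. Qed.

End Logic.

(** * Derived commands *)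

(* The cell 0 of an integer array serves as a scalar variable. *)
Definition Var a : iexp := IGet a (INum 0).
Definition Assign a e : cmd := ISet a (INum 0) e.
Definition BILt e1 e2 : bexp := BNot (BILe e2 e1).
Definition BRLt e1 e2 : bexp := BNot (BRLe e2 e1).
Definition BOr b1 b2 : bexp := BNot (BAnd (BNot b1) (BNot b2)).
Definition BIEq e1 e2 : bexp := BAnd (BILe e1 e2) (BILe e2 e1).
Definition Incr a : cmd := Assign a (IAdd (Var a) (INum 1)).
Notation aSize := 0%N (only parsing).
Definition For a c : cmd :=
  Seq (Assign a (INum 0)) (While (BILt (Var a) (Var aSize)) (Seq c (Incr a))).

Definition for_cost n B : nat := (n * (B + 20) + 20)%N.

Section Derived.
Variable R : realType.
Implicit Types (s : state R).

Lemma beval_lt s e1 e2 : beval s (BILt e1 e2) = (ieval s e1 < ieval s e2)%N.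
Proof. by rewrite /= ltnNge. Qed.

Lemma beval_rlt s e1 e2 : beval s (BRLt e1 e2) = (reval s e1 < reval s e2).
Proof. by rewrite /= real_ltNge ?num_real. Qed.

Lemma beval_or s b1 b2 : beval s (BOr b1 b2) = beval s b1 || beval s b2.
Proof. by rewrite /= negb_and !negbK. Qed.

Lemma beval_and s b1 b2 : beval s (BAnd b1 b2) = beval s b1 && beval s b2.
Proof. by []. Qed.

Lemma beval_not s b : beval s (BNot b) = ~~ beval s b.
Proof. by []. Qed.

Lemma beval_ile s e1 e2 : beval s (BILe e1 e2) = (ieval s e1 <= ieval s e2)%N.
Proof. by []. Qed.

Lemma beval_rle s e1 e2 : beval s (BRLe e1 e2) = (reval s e1 <= reval s e2).
Proof. by []. Qed.

Lemma beval_eq s e1 e2 : beval s (BIEq e1 e2) = (ieval s e1 == ieval s e2).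
Proof. by rewrite /= eqn_leq. Qed.

(** [J i] describes the state after [i] rounds. The body must establish [J i.+1] for the state in
    which the counter has already been advanced, which absorbs the final [Incr]. As [0 < a], the
    counter does not overwrite the input size. *)
Lemma runs_for a c s0 B n (J : nat -> state R -> Prop) :
  (0 < a)%N -> a \notin iwrites c -> aSize \notin iwrites c ->
  imem s0 aSize 0%N = n ->
  J 0%N (iupd s0 a 0 0) ->
  (forall i s, (i < n)%N -> same (For a c) s0 s ->
     imem s a 0%N = i -> J i s ->
     runs c s B (fun s' => J i.+1 (iupd s' a 0 i.+1))) ->
  runs (For a c) s0 (for_cost n B) (J n).
Proof.
move=> a0 ha h0 hn hJ0 hstep.
have s0a : same (For a c) s0 (iupd s0 a 0 0).
  split=> //= b; rewrite inE mem_cat !inE !negb_or => /andP[hb _].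
  exact: upd_other.
(* The guard costs exactly 6, and 7 covers the increment of the counter. *)
suff h : runs (For a c) s0 (cost (Assign a (INum 0)) + (n * ((B + 7) + 6).+1 + 6.+1)) (J n).
  by apply: runs_conseq h _ _ => //=; rewrite /for_cost; lia.
apply: runs_sem_seq => //=.
set b := BILt _ _.
have -> : 6%N = bcost b by [].
pose I m (s : state R) := [/\ imem s aSize 0%N = n, (imem s a 0%N + m = n)%N
   & J (imem s a 0%N) s].
apply: (@runs_while _ b _ _ _ I) => [m s hs [h1 h2 h3]|m s hs [h1 h2 h3]|].
- rewrite beval_lt /= h1 => hlt; split; first lia.
  have ss : same (For a c) s0 s.
    apply: same_trans s0a _; case: hs => hi hr; split=> k; last exact: hr.
    by rewrite /= inE negb_or => /andP[_]; exact: hi.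
  apply: runs_seq.
  apply: (runs_conseq (runs_same (hstep _ _ hlt ss erefl h3))) => // s' [h4 [h5 h6]].
  apply: (@runs_conseq _ _ _ (cost (Incr a))); last by move=> s'' h; exact: h.
    apply: runs_sem => //.
    have e1 : imem s' a 0%N = imem s a 0%N by rewrite h5.
    rewrite /I /= /upd /= e1 !eqxx /= ?addn1; split => //; last lia.
    by rewrite (_ : (0 == a)%N = false) /=; [rewrite h5 | lia].
  by rewrite /=; lia.
- rewrite beval_lt /= h1 -leqNgt => hle.
  by have -> : n = imem s a 0 by lia.
- by split; rewrite /= ?/upd ?eqxx //= (_ : (0 == a)%N = false) //; lia.
Qed.

Definition bevalE :=
  (beval_lt, beval_rlt, beval_or, beval_eq, beval_and, beval_ile, beval_rle,
   beval_not).

End Derived.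

(** * Tournament sort *)

Notation aOut := 1%N (only parsing).
Notation aKey := 2%N (only parsing).
Notation aTree := 3%N (only parsing).
Notation aOrd := 4%N (only parsing).
Notation vI := 20%N (only parsing).
Notation vJ := 21%N (only parsing).
Notation vK := 22%N (only parsing).
Notation vA := 23%N (only parsing).
Notation vB := 24%N (only parsing).
Notation aX := 6%N (only parsing).
Notation aY := 7%N (only parsing).

(* Ties in x are broken by decreasing y, so that a subsequence strictly
   increasing in y is also strictly increasing in x. *)
Definition key_le (R : realType) (k : nat -> nat) (x y : nat -> R) (a b : nat) :=
  (k a < k b)%N ||
  ((k a == k b) && ((x a < x b) || ((x a <= x b) && (y b <= y a)))).

Lemma key_le_total (R : realType) k (x y : nat -> R) a b :
  key_le k x y a b || key_le k x y b a.
Proof.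
rewrite /key_le; case: (ltngtP (k a) (k b)) => //= _.
by case: (ltgtP (x a) (x b)) => //= _; exact: le_total.
Qed.

Lemma key_le_trans (R : realType) k (x y : nat -> R) a b c :
  key_le k x y a b -> key_le k x y b c -> key_le k x y a c.
Proof.
rewrite /key_le.
case: (ltngtP (k a) (k b)) => //= h1; case: (ltngtP (k b) (k c)) => //= h2;
  case: (ltngtP (k a) (k c)) => //= h3; try lia.
clear h1 h2 h3; case: (ltgtP (x a) (x b)) => //= h4; case: (ltgtP (x b) (x c)) => //= h5;
  case: (ltgtP (x a) (x c)) => //= h6; try lra.
Qed.

(* The index n stands for an element larger than all the others. *)
Definition top_le (n : nat) (le : rel nat) : rel nat :=
  fun a b => (n <= b)%N || ((a < n)%N && le a b).

Definition LeKey a b : bexp :=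
  BOr (BILt (IGet aKey a) (IGet aKey b))
      (BAnd (BIEq (IGet aKey a) (IGet aKey b))
            (BOr (BRLt (RGet aX a) (RGet aX b))
                 (BAnd (BRLe (RGet aX a) (RGet aX b))
                       (BRLe (RGet aY b) (RGet aY a))))).

Definition Better a b : bexp :=
  BOr (BILe (Var aSize) b) (BAnd (BILt a (Var aSize)) (LeKey a b)).

(** The tournament tree is stored in an array: node [k] has the children [2k] and [2k + 1], and
    element [i] owns the leaf [n + i]. The match at node [vK] is replayed here; doubling is done by
    addition. *)
Definition Pull : cmd :=
  Seq (Assign vA (IGet aTree (IAdd (Var vK) (Var vK))))
 (Seq (Assign vB (IGet aTree (IAdd (IAdd (Var vK) (Var vK)) (INum 1))))
      (If (Better (Var vA) (Var vB))
          (ISet aTree (Var vK) (Var vA)) (ISet aTree (Var vK) (Var vB)))).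

Definition Build : cmd :=
  Seq (For vI (ISet aTree (IAdd (Var aSize) (Var vI)) (Var vI)))
 (Seq (Assign vK (Var aSize))
      (While (BILe (INum 2) (Var vK))
             (Seq (Assign vK (ISub (Var vK) (INum 1))) Pull))).

Definition Climb : cmd :=
  While (BILe (INum 2) (Var vK)) (Seq (Assign vK (IHalf (Var vK))) Pull).

(** The winner is removed by writing [n], which loses against every element, into its leaf and
    replaying the matches on the path to the root. *)
Definition Extract : cmd :=
  Seq (Assign vJ (IGet aTree (INum 1)))
 (Seq (ISet aOrd (Var vI) (Var vJ))
 (Seq (Assign vK (IAdd (Var aSize) (Var vJ)))
 (Seq (ISet aTree (Var vK) (Var aSize))
      Climb))).

Definition Sort : cmd := Seq Build (For vI Extract).

(** Bounds both the height of a tree with [2n] nodes and the rounds of a binary search. It is at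
    least 2 even for small [n], which lets products with it absorb additive constants. *)
Definition clog n : nat := (trunc_log 2 n).+2.

Lemma clog_ltn n : (n.*2 < 2 ^ clog n)%N.
Proof.
by rewrite /clog [X in (_ < X)%N]expnS mul2n ltn_double trunc_log_ltn.
Qed.

Definition sorted_by n (le : rel nat) (ord : nat -> nat) : Prop :=
  [/\ forall p, (p < n)%N -> (ord p < n)%N,
      forall p q, (p < n)%N -> (q < n)%N -> ord p = ord q -> p = q &
      forall p q, (p <= q)%N -> (q < n)%N -> le (ord p) (ord q)].

(** Pigeonhole; with [f] the order produced so far, it provides an element not yet extracted. *)
Lemma missing_value n p (f : nat -> nat) :
  (p < n)%N -> exists2 i, (i < n)%N & forall q, (q < p)%N -> f q <> i.
Proof.
move=> hp; apply: contrapT => H.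
have hs : {subset iota 0 n <= mkseq f p}.
  move=> i; rewrite mem_iota add0n => /andP[_ hi]; apply: contrapT => hn.
  apply: H; exists i => // q hq e; apply: hn; rewrite -e.
  by apply/mapP; exists q => //; rewrite mem_iota.
have := uniq_leq_size (iota_uniq 0 n) hs; rewrite size_iota size_mkseq; lia.
Qed.

Lemma sorted_by_surj n le ord i :
  sorted_by n le ord -> (i < n)%N -> exists2 p, (p < n)%N & ord p = i.
Proof.
move=> [h1 h2 _] hi; apply: contrapT => H.
have hs : {subset i :: mkseq ord n <= iota 0 n}.
  move=> j; rewrite inE mem_iota add0n => /orP[/eqP->//|/mapP[q]].
  by rewrite mem_iota => /andP[_ hq] ->; exact: h1.
have hu : uniq (i :: mkseq ord n).
  rewrite /= map_inj_in_uniq ?iota_uniq ?andbT.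
    apply/mapP => -[q]; rewrite mem_iota => /andP[_ hq] e.
    by apply: H; exists q.
  by move=> a b; rewrite !mem_iota; exact: h2.
have := uniq_leq_size hu hs; rewrite /= size_iota size_mkseq; lia.
Qed.

(** * Tournament trees as heaps *)

Section Heap.
Variables (n : nat) (le : rel nat).
Hypothesis le_refl : forall a, le a a.
Hypothesis le_trans : forall a b c, le a b -> le b c -> le a c.

(** The first clause makes each inner node repeat a child, hence ultimately a leaf; the order alone
    would allow a root foreign to the leaves. *)
Definition heapat (t : nat -> nat) k : Prop :=
  [/\ t k = t k.*2 \/ t k = t k.*2.+1, le (t k) (t k.*2) & le (t k) (t k.*2.+1)].

Definition heap t : Prop := forall k, (0 < k < n)%N -> heapat t k.

Lemma heap_min t k : heap t -> (0 < k < n.*2)%N -> le (t 1%N) (t k).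
Proof.
move=> ht; elim/ltn_ind: k => k IH hk.
case: (leqP k 1) => h1; first by have -> : k = 1%N by lia.
have := IH k./2; have -> : (k./2 < k)%N by lia.
have -> : (0 < k./2 < n.*2)%N by lia.
move=> /(_ isT isT) h2; apply: le_trans h2 _.
have [|_ h3 h4] := ht k./2; first lia.
by have := odd_double_half k; case: (odd k) => /= e; rewrite -{2}e.
Qed.

Lemma heap_leaf t k : heap t -> (0 < k < n.*2)%N ->
  exists2 i, (i < n)%N & t k = t (n + i)%N.
Proof.
move=> ht; have [m] := ubnP (n.*2 - k)%N; elim: m k => // m IH k hm hk.
case: (leqP n k) => h1.
  by exists (k - n)%N; [lia|congr t; lia].
have [|[] e _ _] := ht k; first lia.
  by have [||i hi e'] := IH k.*2; [lia|lia|exists i => //; rewrite e].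
by have [||i hi e'] := IH k.*2.+1; [lia|lia|exists i => //; rewrite e].
Qed.

End Heap.

Section SortSpec.
Variable R : realType.
Implicit Types (s : state R).

Definition keyrel s : rel nat := key_le (imem s aKey) (rmem s aX) (rmem s aY).

Definition order_le s : rel nat := top_le (imem s aSize 0%N) (keyrel s).

Lemma beval_Better s a b :
  beval s (Better a b) = order_le s (ieval s a) (ieval s b).
Proof.
by rewrite /Better /LeKey !bevalE.
Qed.

End SortSpec.

Definition pulled (le : rel nat) (t : nat -> nat) k : nat -> nat :=
  fun j => if j == k then (if le (t k.*2) (t k.*2.+1) then t k.*2 else t k.*2.+1)
           else t j.

Lemma pulled_at (le : rel nat) t k :
  (forall a b, le a b || le b a) -> (0 < k)%N -> heapat le (pulled le t k) k.
Proof.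
move=> tot k0; rewrite /heapat /pulled eqxx.
rewrite (_ : (k.*2 == k) = false); last lia.
rewrite (_ : (k.*2.+1 == k) = false); last lia.
case: ifP => h; split; auto.
- by have := tot (t k.*2) (t k.*2); rewrite orbb.
- by have := tot (t k.*2) (t k.*2.+1); rewrite h.
- by have := tot (t k.*2.+1) (t k.*2.+1); rewrite orbb.
Qed.

(** The condition at [j] only reads [j] and its two children, so a change at [k] concerns only [k]
    and its parent. *)
Lemma pulled_other (le : rel nat) t k j :
  j <> k -> j <> k./2 -> heapat le t j -> heapat le (pulled le t k) j.
Proof.
move=> h1 h2; rewrite /heapat /pulled (_ : (j == k) = false); last lia.
rewrite (_ : (j.*2 == k) = false); last lia.
by rewrite (_ : (j.*2.+1 == k) = false); last lia.
Qed.

Lemma top_le_total n (le : rel nat) :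
  (forall a b, le a b || le b a) -> forall a b, top_le n le a b || top_le n le b a.
Proof.
move=> tot a b; rewrite /top_le; have := tot a b.
by case: (leqP n a); case: (leqP n b); rewrite ?orbT.
Qed.

Lemma top_le_trans n (le : rel nat) :
  (forall a b c, le a b -> le b c -> le a c) ->
  forall a b c, top_le n le a b -> top_le n le b c -> top_le n le a c.
Proof.
move=> tr a b c; rewrite /top_le; case: (leqP n c) => //= hc.
case: (leqP n b) => //= hb /andP[-> h1] h2; exact: tr h1 h2.
Qed.

(** * Correctness and cost of the tournament sort *)

Section SortCorrect.
Variable R : realType.
Implicit Types (s : state R).

Lemma tree_pull s :
  imem (sem Pull s) aTree = pulled (order_le s) (imem s aTree) (imem s vK 0%N).
Proof.
pose s2 : state R := sem (Assign vB (IGet aTree (IAdd (IAdd (Var vK) (Var vK)) (INum 1))))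
  (sem (Assign vA (IGet aTree (IAdd (Var vK) (Var vK)))) s).
have -> : sem Pull s = if beval s2 (Better (Var vA) (Var vB))
  then iupd s2 aTree (imem s2 vK 0%N) (imem s2 vA 0%N)
  else iupd s2 aTree (imem s2 vK 0%N) (imem s2 vB 0%N) by [].
rewrite beval_Better; have -> : order_le s2 = order_le s by [].
apply/funext => j; rewrite /pulled /= /upd /= addnn addn1.
by case: ifP => _; rewrite /= /upd /=.
Qed.

Lemma order_le_same c s s' : same c s s' ->
  aSize \notin iwrites c -> aKey \notin iwrites c ->
  aX \notin rwrites c -> aY \notin rwrites c -> order_le s' = order_le s.
Proof.
by move=> [h1 h2] ? ? ? ?; rewrite /order_le /keyrel !h1 // !h2.
Qed.

Lemma order_le_total s a b : order_le s a b || order_le s b a.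
Proof. by apply: top_le_total => i j; exact: key_le_total. Qed.

Lemma order_le_refl s a : order_le s a a.
Proof. by have := order_le_total s a a; rewrite orbb. Qed.

Lemma order_le_trans s a b c : order_le s a b -> order_le s b c -> order_le s a c.
Proof. by apply: top_le_trans => i j k; exact: key_le_trans. Qed.

Definition leaves n (t : nat -> nat) (removed : nat -> Prop) : Prop :=
  forall i, (i < n)%N -> (removed i -> t (n + i)%N = n) /\
                         (~ removed i -> t (n + i)%N = i).

Lemma runs_build s n : imem s aSize 0%N = n ->
  runs Build s (200 * n.+1)%N (fun s' =>
    heap n (order_le s') (imem s' aTree) /\
    leaves n (imem s' aTree) (fun=> False)).
Proof.
move=> hn.
pose J i (s' : state R) := forall j, (j < i)%N -> imem s' aTree (n + j)%N = j.
apply: (@runs_le _ (for_cost n 20 + (cost (Assign vK (Var aSize)) +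
   (n * (cost (Seq (Assign vK (ISub (Var vK) (INum 1))) Pull)
      + bcost (BILe (INum 2) (Var vK))).+1 + (bcost (BILe (INum 2) (Var vK))).+1)))%N); last first.
  by rewrite /for_cost /=; lia.
apply: runs_seq.
have H := @runs_for R vI (ISet aTree (IAdd (Var aSize) (Var vI)) (Var vI)) s 20 n J.
apply: (runs_conseq (runs_same (H isT isT isT hn _ _))) => //.
  move=> i s' hi hs' e hJ.
  apply: runs_sem_le => // j; rewrite ltnS => hj; rewrite /= /upd /=.
  have hn' : imem s' 0%N 0%N = n by rewrite -hn; have [->] := hs'.
  rewrite e hn' eqn_add2l; case: eqP => [->//|/eqP hne]; apply: hJ; lia.
move=> s1 [hJ hs1]; apply: runs_sem_seq => //; set s2 := sem _ _.
have sz c s' : 0%N \notin iwrites c -> same c s2 s' -> imem s' 0%N 0%N = n.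
  by move=> hc [hs' _]; rewrite hs' // /s2 /= /upd /=; have [->] := hs1.
(* The matches are played from node [n - 1] down to node 1, so the nodes from [vK] on are already
   correct. *)
pose I m (s' : state R) := [/\ (imem s' vK 0%N).-1 = m, (imem s' vK 0%N <= n)%N,
  ((0 < n) -> 0 < imem s' vK 0%N)%N,
  forall k, (imem s' vK 0%N <= k < n)%N -> heapat (order_le s') (imem s' aTree) k &
  leaves n (imem s' aTree) (fun=> False)].
apply: (@runs_le _ (n.-1 * (cost (Seq (Assign vK (ISub (Var vK) (INum 1))) Pull)
      + bcost (BILe (INum 2) (Var vK))).+1 + (bcost (BILe (INum 2) (Var vK))).+1)%N);
  last by lia.
apply: (@runs_while _ _ _ _ _ I) => [m s' hs' [h1 h2 h3 h4 h5] hb|m s' hs' [h1 h2 h3 h4 h5] hb|].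
- split; first by move: hb; rewrite /=; lia.
  apply: runs_sem => //; rewrite [sem _ _]/=.
  set k := imem s' vK 0%N in h1 h2 h3 h4 *.
  have k2 : (1 < k)%N by move: hb; rewrite /= -/k.
  rewrite -/k; set sK := iupd s' _ _ _.
  have sp := sem_same sK (isT : loopfree Pull).
  have eK : imem (sem Pull sK) vK 0%N = k.-1.
    by rewrite sp.1 //= /upd /=; lia.
  have eT : imem (sem Pull sK) aTree = pulled (order_le s') (imem s' aTree) k.-1.
    by rewrite tree_pull /= /upd /= subn1.
  have eO : order_le (sem Pull sK) = order_le s'.
    by rewrite (order_le_same sp).
  rewrite /I eK eT eO; split; [lia|lia|lia| |].
    move=> j hj; case: (eqVneq j k.-1) => [->|hne].
      apply: pulled_at; last lia.
      exact: order_le_total.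
    apply: pulled_other; [lia|lia|apply: h4; lia].
  move=> i hi; rewrite /pulled (_ : (n + i == k.-1)%N = false); last lia.
  exact: h5.
- split=> // k hk; apply: h4; move: hb; rewrite /=; lia.
- have e0 : imem s1 0%N 0%N = n by rewrite -hn; have [->] := hs1.
  rewrite /I /s2 /= /upd /= e0; split=> //; first lia.
  by move=> i hi; split=> // _; exact: hJ.
Qed.

(** After a change at a leaf only its proper ancestors are suspect, namely its quotients by positive
    powers of 2. Replaying the match at the parent moves the suspects one level up, until none is
    left at the root. *)
Lemma runs_climb s n : imem s aSize 0%N = n ->
  (0 < imem s vK 0%N < n.*2)%N ->
  (forall j, (0 < j < n)%N -> (forall m, j <> imem s vK 0%N %/ 2 ^ m.+1)%N ->
     heapat (order_le s) (imem s aTree) j) ->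
  runs Climb s (150 * clog n)%N (fun s' =>
    heap n (order_le s') (imem s' aTree) /\
    forall i, imem s' aTree (n + i)%N = imem s aTree (n + i)%N).
Proof.
move=> hn hk hH.
pose I m (s' : state R) := [/\ (0 < imem s' vK 0 < n.*2)%N,
  (imem s' vK 0 < 2 ^ m.+1)%N,
  forall j, (0 < j < n)%N -> (forall m, j <> imem s' vK 0%N %/ 2 ^ m.+1)%N ->
     heapat (order_le s') (imem s' aTree) j &
  forall i, imem s' aTree (n + i)%N = imem s aTree (n + i)%N].
apply: (@runs_le _ (clog n * (cost (Seq (Assign vK (IHalf (Var vK))) Pull)
  + bcost (BILe (INum 2) (Var vK))).+1 + (bcost (BILe (INum 2) (Var vK))).+1)%N);
  last by rewrite [cost _]/= [bcost _]/=; have : (1 < clog n)%N by []; nia.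
apply: (@runs_while _ _ _ _ _ I) => [m s' hs' [h1 h2 h3 h4] hb|m s' hs' [h1 h2 h3 h4] hb|].
- have k2 : (1 < imem s' vK 0%N)%N by move: hb; rewrite /=.
  split; first by case: m h2 => //; rewrite expn1; lia.
  apply: runs_sem => //; rewrite [sem _ _]/=.
  set k := imem s' vK 0%N in h1 h2 h3 k2 *.
  set sK := iupd s' _ _ _.
  have sp := sem_same sK (isT : loopfree Pull).
  have eK : imem (sem Pull sK) vK 0%N = k./2 by rewrite sp.1.
  have eT : imem (sem Pull sK) aTree = pulled (order_le s') (imem s' aTree) k./2.
    by rewrite tree_pull.
  have eO : order_le (sem Pull sK) = order_le s' by rewrite (order_le_same sp).
  have hk2 : (k./2 < n)%N by lia.
  rewrite /I eK eT eO; split; [lia| | |].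
  + case: m h2 => [|m]; first by rewrite expn1; lia.
    by rewrite [X in (k < X)%N -> _]expnS => h2 /=; lia.
  + move=> j hj hne; case: (eqVneq j k./2) => [->|hne'].
      by apply: pulled_at; [exact: order_le_total|lia].
    apply: pulled_other; [lia| |].
      by move=> e; apply: (hne 0%N); rewrite expn1 divn2.
    apply: h3 => // -[|m'] e; first by move: hne'; rewrite e expn1 divn2 eqxx.
    by apply: (hne m'); rewrite e [in LHS]expnS divnMA divn2.
  + by move=> i; rewrite -h4 /pulled (_ : (n + i == k./2)%N = false) //; lia.
- have k1 : imem s' vK 0%N = 1%N by move: hb; rewrite /=; lia.
  split=> // j hj; apply: h3 => // m'; rewrite k1 divn_small; first lia.
  by have := @ltn_expl 2 m'.+1 isT; lia.
- by split=> //; have := clog_ltn n; rewrite expnS; lia.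
Qed.

Lemma runs_sort s n : imem s aSize 0%N = n ->
  runs Sort s (600 * (n.+1 * clog n))%N (fun s' =>
    sorted_by n (keyrel s) (imem s' aOrd)).
Proof.
move=> hn.
apply: (@runs_le _ (200 * n.+1 + for_cost n (60 + 150 * clog n))%N); last first.
  by rewrite /for_cost; have : (1 < clog n)%N by []; nia.
apply: runs_seq; apply: (runs_conseq (runs_same (runs_build hn))) => // s1 [[h1 h2] ss1].
have eR : keyrel s1 = keyrel s by rewrite /keyrel !ss1.1 // !ss1.2.
have hn1 : imem s1 aSize 0%N = n by rewrite ss1.1.
(* The last clause keeps every extracted element below all the remaining ones, so that the next
   winner can be appended to the sorted part. *)
pose J p (s' : state R) := let ord := imem s' aOrd in
  [/\ heap n (order_le s') (imem s' aTree),
   leaves n (imem s' aTree) (fun i => exists2 q, (q < p)%N & ord q = i),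
   (forall q, (q < p)%N -> (ord q < n)%N) /\
   (forall q r, (q < p)%N -> (r < p)%N -> ord q = ord r -> q = r),
   (forall q r, (q <= r)%N -> (r < p)%N -> keyrel s (ord q) (ord r)) &
   (forall q i, (q < p)%N -> (i < n)%N -> (forall r, (r < p)%N -> ord r <> i) ->
     keyrel s (ord q) i)].
suff H : runs (For vI Extract) s1 (for_cost n (60 + 150 * clog n)) (J n).
  apply: (runs_conseq H) => // s' [_ _ [j1 j2] j3 _]; split=> //.
apply: runs_for => //.
  split=> //= i hi; have [_ e] := h2 i hi; split=> [[]//|_]; exact: e.
move=> p s2 hp ss2 ei [j1 j2 [j3 j3'] j4 j5].
have hn2 : imem s2 aSize 0%N = n by rewrite -hn1 ss2.1.
have eR2 : keyrel s2 = keyrel s by rewrite -eR /keyrel !ss2.1 // !ss2.2.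
have eO2 : order_le s2 = top_le n (keyrel s) by rewrite /order_le eR2 hn2.
rewrite eO2 in j1.
set t := imem s2 aTree in j1 j2.
set ord := imem s2 aOrd in j2 j3 j3' j4 j5.
have tot : forall a b, top_le n (keyrel s) a b || top_le n (keyrel s) b a.
  by move=> a b; rewrite -eO2; exact: order_le_total.
have tr : forall a b c, top_le n (keyrel s) a b -> top_le n (keyrel s) b c ->
    top_le n (keyrel s) a c by move=> a b c; rewrite -eO2; exact: order_le_trans.
have rf : forall a, top_le n (keyrel s) a a by move=> a; rewrite -eO2; exact: order_le_refl.
(* Since [p < n], some element is still in the tree. The root precedes it, so the root cannot be the
   sentinel [n] and is a genuine remaining element. *)
have [i0 i0n i0new] := missing_value ord hp.
have tmin i : (i < n)%N -> (forall r, (r < p)%N -> ord r <> i) ->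
    top_le n (keyrel s) (t 1%N) i.
  move=> hi hnew; have [_ <-] := j2 i hi; last by case=> r /hnew.
  by apply: (heap_min rf tr j1); lia.
have [j jn tj] : exists2 i, (i < n)%N & t 1%N = t (n + i)%N.
  by apply: (heap_leaf j1); lia.
have t1n : (t 1%N < n)%N.
  have := tmin i0 i0n i0new; rewrite /top_le; lia.
have [jnew ej] : (forall r, (r < p)%N -> ord r <> j) /\ t 1%N = j.
  have [k1 k2] := j2 j jn.
  case: (pselect (exists2 q, (q < p)%N & ord q = j)) => hq.
    by move: t1n; rewrite tj k1 //; lia.
  by rewrite tj k2 //; split=> // r hr e; apply: hq; exists r.
have kmin i : (i < n)%N -> (forall r, (r < p)%N -> ord r <> i) -> keyrel s j i.
  by move=> hi hnew; have := tmin i hi hnew; rewrite /top_le ej; lia.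
apply: (@runs_le _ (50 + 150 * clog n)%N); last lia.
pose c1 := Seq (Assign vJ (IGet aTree (INum 1)))
 (Seq (ISet aOrd (Var vI) (Var vJ))
 (Seq (Assign vK (IAdd (Var aSize) (Var vJ)))
      (ISet aTree (Var vK) (Var aSize)))).
set s3 := sem c1 s2.
have ss3 : same c1 s2 s3 by exact: sem_same.
have e3K : imem s3 vK 0%N = (n + j)%N by rewrite /s3 /= /upd /= hn2 -/t ej.
have e3T : imem s3 aTree = fun k => if k == (n + j)%N then n else t k.
  by apply/funext => k; rewrite /s3 /= /upd /= hn2 -/t ej.
have e3O : imem s3 aOrd = fun q => if q == p then j else ord q.
  by apply/funext => k; rewrite /s3 /= /upd /= ei -/t ej.
have e3R : order_le s3 = top_le n (keyrel s).
  by rewrite (order_le_same ss3).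
have e3n : imem s3 aSize 0%N = n by rewrite ss3.1.
have hC : runs Climb s3 (150 * clog n) (fun s' =>
    heap n (order_le s') (imem s' aTree) /\
    forall i, imem s' aTree (n + i)%N = imem s3 aTree (n + i)%N).
  apply: runs_climb => //; rewrite ?e3K; first lia.
  move=> k hk hnk; rewrite e3R e3T; have := j1 k hk; rewrite /heapat.
  have h0 := hnk 0%N; rewrite expn1 divn2 in h0.
  rewrite (_ : (k == (n + j)%N) = false); last lia.
  rewrite (_ : (k.*2 == (n + j)%N) = false); last lia.
  by rewrite (_ : (k.*2.+1 == (n + j)%N) = false); last lia.
have hC2 : runs Extract s2 (50 + 150 * clog n) (fun s' =>
    (heap n (order_le s') (imem s' aTree) /\
    forall i, imem s' aTree (n + i)%N = imem s3 aTree (n + i)%N) /\ same Climb s3 s').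
  rewrite /Extract.
  apply: (@runs_le _ (cost (Assign vJ (IGet aTree (INum 1))) +
   (cost (ISet aOrd (Var vI) (Var vJ)) + (cost (Assign vK (IAdd (Var aSize) (Var vJ)))
   + (cost (ISet aTree (Var vK) (Var aSize)) + 150 * clog n)))))%N; last by rewrite /=; lia.
  do 4!(apply: runs_sem_seq => //).
  exact: runs_same hC.
apply: (runs_conseq hC2) => // s4 [[k1 k2] ss4].
have eO4 : order_le s4 = top_le n (keyrel s) by rewrite (order_le_same ss4).
have e4O : imem s4 aOrd = fun q => if q == p then j else ord q by rewrite ss4.1.
rewrite /J; set s5 := iupd s4 _ _ _.
have -> : imem s5 aOrd = fun q => if q == p then j else ord q by rewrite -e4O.
have -> : imem s5 aTree = imem s4 aTree by [].
have -> : order_le s5 = order_le s4 by [].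
split=> //.
- move=> i hi; rewrite k2 e3T eqn_add2l; have [l1 l2] := j2 i hi.
  case: eqP => [->|hne]; split=> //.
    by case; exists p; rewrite ?eqxx.
  + case=> q hq; case: eqP => [_ e|hqp e]; first by rewrite e in hne.
    by apply: l1; exists q => //; lia.
  + move=> hnq; apply: l2 => -[q hq e]; apply: hnq; exists q; first lia.
    by rewrite (_ : (q == p) = false) //; lia.
- split=> [q hq|q r hq hr].
    by case: eqP => // hqp; apply: j3; lia.
  case: eqP => hqp; case: eqP => hrp; first by rewrite hqp hrp.
  + by move=> e; case: (@jnew r) => //; lia.
  + by move=> e; case: (@jnew q) => //; lia.
  + by apply: j3'; lia.
- move=> q r hqr hr; case: eqP => hqp; case: eqP => hrp; try lia.
  + by apply: kmin.
  + by apply: j5 => //; lia.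
  + by apply: j4; lia.
- move=> q i hq hi hnew.
  have inew : forall r, (r < p)%N -> ord r <> i.
    move=> r hr; have := hnew r; rewrite (_ : (r == p) = false); last lia.
    by apply; lia.
  by case: eqP => hqp; [apply: kmin|apply: j5 => //; lia].
Qed.

End SortCorrect.

(** * Slabs *)

Notation aC := 5%N (only parsing).
Notation aRes := 6%N (only parsing).
Notation aS := 7%N (only parsing).
Notation vC := 25%N (only parsing).
Notation vR := 26%N (only parsing).
Notation aW := 8%N (only parsing).

Definition NewSlab : bexp :=
  BOr (BNot (BIEq (IGet aKey (IGet aS (Var vC))) (IGet aKey (Var vJ))))
      (BRLe (RAdd (RGet aX (IGet aS (Var vC))) (RGet aW (IGet aS (Var vC))))
            (RGet aX (Var vJ))).

(** The residue modulo 3 of the slab number is carried along in [vR] as a wrapping counter, as there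
    is no integer division by 3. *)
Definition OpenSlab : cmd :=
  Seq (Incr vC)
 (Seq (Incr vR)
 (Seq (If (BILe (INum 3) (Var vR)) (Assign vR (INum 0)) Skip)
      (ISet aS (Var vC) (Var vJ)))).

Definition ScanStep : cmd :=
  Seq (Assign vJ (IGet aOrd (Var vI)))
 (Seq (If NewSlab OpenSlab Skip)
 (Seq (ISet aC (Var vJ) (Var vC))
      (ISet aRes (Var vJ) (Var vR)))).

Definition Scan : cmd :=
  Seq (Assign vC (INum 0))
 (Seq (Assign vR (INum 0))
 (Seq (ISet aS (INum 0) (IGet aOrd (INum 0)))
      (For vI ScanStep))).

(** * Greedy cutting of a sorted sequence into slabs *)

Section ScanCorrect.
Variable R : realType.
Implicit Types (s : state R).

(* C i is the number of the slab of i, and S c is the element of slab number c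
   at which that slab starts; its width is W (S c). *)
Definition slabs n (K : nat -> nat) (X W : nat -> R) (C S : nat -> nat) cm : Prop :=
  [/\ forall i, (i < n)%N -> [/\ (C i <= cm)%N, K (S (C i)) = K i
        & X (S (C i)) <= X i < X (S (C i)) + W (S (C i))],
      forall c, (0 < n)%N -> (c <= cm)%N -> (S c < n)%N &
      forall c, (c < cm)%N -> (K (S c) <= K (S c.+1))%N /\
        (K (S c) = K (S c.+1) -> X (S c) + W (S c) <= X (S c.+1))].

Definition scan_post n s (s' : state R) : Prop :=
  slabs n (imem s aKey) (rmem s aX) (rmem s aW) (imem s' aC) (imem s' aS)
    (imem s' vC 0%N) /\
  (forall i, (i < n)%N -> imem s' aRes i = imem s' aC i %% 3)%N.

(** The elements arrive by increasing key and then increasing coordinate, so each needs to be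
    compared only with the slab opened last. *)
Lemma runs_scan s n : imem s aSize 0%N = n ->
  sorted_by n (keyrel s) (imem s aOrd) ->
  (forall i, (i < n)%N -> 0 < rmem s aW i) ->
  runs Scan s (400 * n.+1)%N (scan_post n s).
Proof.
move=> hn [ or1 or2 or3] hW.
set K := imem s aKey; set X := rmem s aX; set W := rmem s aW.
set ord := imem s aOrd in or1 or2 or3.
apply: (@runs_le _ (cost (Assign vC (INum 0)) + (cost (Assign vR (INum 0)) +
  (cost (ISet aS (INum 0) (IGet aOrd (INum 0))) + for_cost n 200)))%N);
  last by rewrite /for_cost /=; lia.
do 3!(apply: runs_sem_seq => //).
(* Slab 0 is opened at [ord 0] before the loop, whence [maxn p 1] in place of [p]. *)
pose J p (s' : state R) := let c := imem s' vC 0%N in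
  let C := imem s' aC in let S := imem s' aS in
  [/\ forall q, (q < p)%N -> let i := ord q in
       [/\ (C i <= c)%N, K (S (C i)) = K i,
           X (S (C i)) <= X i < X (S (C i)) + W (S (C i)) &
           imem s' aRes i = (C i %% 3)%N],
      imem s' vR 0%N = (c %% 3)%N,
      forall c', (c' <= c)%N -> exists2 q, (q < maxn p 1)%N & S c' = ord q &
      forall c', (c' < c)%N -> (K (S c') <= K (S c'.+1))%N /\
        (K (S c') = K (S c'.+1) -> X (S c') + W (S c') <= X (S c'.+1))].
set s1 := sem _ _.
suff H : runs (For vI ScanStep) s1 (for_cost n 200) (J n).
  apply: (runs_conseq H) => // s' [h1 h2 h3 h4]; split.
    split=> //.
      move=> i hi; have [q hq <-] := sorted_by_surj (And3 or1 or2 or3) hi.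
      by have [] := h1 q hq.
    move=> c n0 hc; have [q hq ->] := h3 c hc; apply: or1; lia.
  move=> i hi; have [q hq <-] := sorted_by_surj (And3 or1 or2 or3) hi.
  by have [] := h1 q hq.
apply: runs_for => //.
  split=> //= c'; rewrite /s1 /= /upd /= leqn0 => /eqP->.
  by exists 0%N.
move=> p s2 hp ss2 ei [h1 h2 h3 h4].
have eO : imem s2 aOrd = ord by rewrite ss2.1.
have eK : imem s2 aKey = K by rewrite ss2.1.
have eX : rmem s2 aX = X by rewrite ss2.2.
have eW : rmem s2 aW = W by rewrite ss2.2.
apply: runs_sem_le => //.
set c := imem s2 vC 0%N in h1 h2 h3 h4.
set C := imem s2 aC in h1.
set S := imem s2 aS in h1 h3 h4.
set j := ord p.
pose s3 := sem (Assign vJ (IGet aOrd (Var vI))) s2.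
have e3J : imem s3 vJ 0%N = j by rewrite /s3 /= /upd /= ei eO.
have -> : sem ScanStep s2 = sem (Seq (ISet aC (Var vJ) (Var vC))
      (ISet aRes (Var vJ) (Var vR))) (if beval s3 NewSlab then sem OpenSlab s3 else s3) by [].
have -> : beval s3 NewSlab = (K (S c) != K j) || (X (S c) + W (S c) <= X j).
  rewrite /NewSlab !bevalE.
  by rewrite [ieval _ _]/= [reval _ _]/= /s3 /= /upd /= eK eX eW ei eO.
have [q0 hq0 eS] := h3 c (leqnn _).
have := or3 q0 p; rewrite -eS -/j hp => /(_ _ isT).
have -> : (q0 <= p)%N by lia.
move=> /(_ isT); rewrite /keyrel /key_le -/K -/X => hle.
have jn : (j < n)%N by exact: or1.
have jW := hW _ jn; rewrite -/W in jW.
have c3 : (c.+1 %% 3 = if 3 <= (c %% 3).+1 then 0 else (c %% 3).+1)%N.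
  by case: ifP; lia.
(* The two closing assignments and the counter update are computed once, for both outcomes of the
   test [NewSlab]. *)
pose J' (s' : state R) := forall cc rr SS,
   imem s' vC 0%N = cc -> imem s' vR 0%N = rr -> imem s' aS = SS -> imem s' vJ 0%N = j -> 
   imem s' aC = C -> imem s' aRes = imem s2 aRes ->
   let s4 := sem (Seq (ISet aC (Var vJ) (Var vC)) (ISet aRes (Var vJ) (Var vR))) s' in
   let s5 := iupd s4 vI 0 p.+1 in
   [/\ imem s5 vC 0%N = cc, imem s5 vR 0%N = rr, imem s5 aS = SS,
       imem s5 aC = fun i => if i == j then cc else C i &
       imem s5 aRes = fun i => if i == j then rr else imem s2 aRes i].
have HJ s' : J' s'.
  move=> cc rr SS f1 f2 f3 f4 f5 f6; split; rewrite ?f1 ?f2 ?f3 //.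
    by apply/funext => i; rewrite /= /upd /= f4 f1 f5.
  by apply/funext => i; rewrite /= /upd /= f4 f2 f6.
case: ifP => hb.
  pose S' := fun c' => if c' == c.+1 then j else S c'.
  have [||||||f1 f2 f3 f4 f5] := HJ (sem OpenSlab s3) c.+1 (c.+1 %% 3)%N S'.
  - by rewrite /= /upd /=; case: (2 < _)%N; rewrite /= /upd /= addn1.
  - rewrite c3 -h2 /= /upd /=; rewrite addn1.
    by case: (2 < _)%N; rewrite /= /upd /= ?addn1.
  - by apply/funext => k; rewrite /= /upd /=; case: (2 < _)%N; rewrite /= /upd /= addn1 ei eO.
  - by rewrite /= /upd /=; case: (2 < _)%N; rewrite /= /upd /= ei eO.
  - by rewrite /= /upd /=; case: (2 < _)%N.
  - by rewrite /= /upd /=; case: (2 < _)%N.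
  rewrite /J f1 f2 f3 f4 f5; split=> //.
  + move=> q hq /=; case: (eqVneq (ord q) j) => [->|hne].
      by rewrite /S' eqxx; split=> //; rewrite lexx ltrDl jW.
    have hqp : (q < p)%N.
      by case: (eqVneq q p) => [e|]; [rewrite e eqxx in hne|lia].
    have [g1 g2 g3 g4] := h1 q hqp.
    have hne' : (C (ord q) == c.+1) = false by apply/negbTE; rewrite neq_ltn ltnS g1.
    by rewrite /S' hne'; split=> //; exact: leqW.
  + move=> c' hc'; rewrite /S'; case: eqP => hcc; first by exists p => //; lia.
    by have [|q hq ->] := h3 c'; [lia|exists q => //; lia].
  + move=> c' hc'; rewrite /S' (_ : (c' == c.+1) = false); last lia.
    case: eqP => hcc.
      have -> : c' = c by lia.
      split; first by move: hle; lia.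
      by move=> e; move: hb; rewrite e eqxx.
    by apply: h4; lia.
have [||||||f1 f2 f3 f4 f5] := HJ s3 c (c %% 3)%N S => //.
rewrite /J f1 f2 f3 f4 f5; split=> //.
+ move=> q hq /=; case: (eqVneq (ord q) j) => [->|hne].
    move: hb => /negbT; rewrite negb_or negbK => /andP[/eqP e hlt].
    split=> //; rewrite e eqxx ltnn /= in hle.
    by rewrite real_ltNge ?num_real // hlt andbT; move: hle => /orP[/ltW|/andP[]].
  have hqp : (q < p)%N.
    by case: (eqVneq q p) => [e|]; [rewrite e eqxx in hne|lia].
  exact: h1.
+ by move=> c' hc'; have [|q hq ->] := h3 c'; [lia|exists q => //; lia].
Qed.

End ScanCorrect.

(** * Longest chain *)

Notation aTop := 10%N (only parsing).
Notation aPred := 11%N (only parsing).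
Notation aChain := 12%N (only parsing).
Notation vLen := 27%N (only parsing).
Notation vLo := 28%N (only parsing).
Notation vHi := 29%N (only parsing).
Notation vMid := 30%N (only parsing).

Definition PosLt p q : bexp :=
  BOr (BILt (IGet aKey (IGet aOrd p)) (IGet aKey (IGet aOrd q)))
      (BAnd (BIEq (IGet aKey (IGet aOrd p)) (IGet aKey (IGet aOrd q)))
            (BRLt (RGet aY (IGet aOrd p)) (RGet aY (IGet aOrd q)))).

Definition SearchStep : cmd :=
  Seq (Assign vMid (IHalf (IAdd (Var vLo) (Var vHi))))
      (If (PosLt (IGet aTop (IAdd (Var vMid) (INum 1))) (Var vI))
          (Assign vLo (IAdd (Var vMid) (INum 1)))
          (Assign vHi (Var vMid))).

Definition Search : cmd :=
  Seq (Assign vLo (INum 0))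
 (Seq (Assign vHi (Var vLen))
      (While (BILt (Var vLo) (Var vHi)) SearchStep)).

(** When [vLo] is 0 the predecessor copied from [aTop] is meaningless; it belongs to an element of
    level 1, where backtracking stops. *)
Definition Insert : cmd :=
  Seq (ISet aPred (Var vI) (IGet aTop (Var vLo)))
 (Seq (ISet aTop (IAdd (Var vLo) (INum 1)) (Var vI))
      (If (BILe (Var vLen) (Var vLo)) (Assign vLen (IAdd (Var vLo) (INum 1))) Skip)).

Definition BackStep : cmd :=
  Seq (ISet aChain (Var vK) (Var vJ))
 (Seq (Assign vJ (IGet aPred (Var vJ)))
      (Assign vK (ISub (Var vK) (INum 1)))).

Definition Backtrack : cmd :=
  Seq (Assign vK (Var vLen))
 (Seq (Assign vJ (IGet aTop (Var vLen)))
      (While (BILe (INum 1) (Var vK)) BackStep)).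

Definition Longest : cmd :=
  Seq (Assign vLen (INum 0)) (Seq (For vI (Seq Search Insert)) Backtrack).

(** * Patience sorting *)

Section LongestCorrect.
Variable R : realType.
Implicit Types (s : state R).

Definition pos_lt s : rel nat := fun p q =>
  let k i := imem s aKey (imem s aOrd i) in
  let y i := rmem s aY (imem s aOrd i) in
  (k p < k q)%N || ((k p == k q) && (y p < y q)).

Lemma pos_lt_trans s a b c : pos_lt s a b -> pos_lt s b c -> pos_lt s a c.
Proof.
rewrite /pos_lt /=; move: (imem s aKey) => k; move: (imem s aOrd) => f.
case: (ltngtP (k (f a)) (k (f b))) => //= h1; case: (ltngtP (k (f b)) (k (f c))) => //= h2;
  case: (ltngtP (k (f a)) (k (f c))) => //= h3; try lia.
exact: lt_trans.
Qed.

(** The comparison is a strict weak order; this form of it lets the top of a level be replaced by an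
    element that is not above it. *)
Lemma pos_lt_ntrans s a b c :
  ~~ pos_lt s a b -> pos_lt s a c -> pos_lt s b c.
Proof.
rewrite /pos_lt /=; move: (imem s aKey) => k; move: (imem s aOrd) => f.
case: (ltngtP (k (f a)) (k (f b))) => //= h1; case: (ltngtP (k (f b)) (k (f c))) => //= h2;
  case: (ltngtP (k (f a)) (k (f c))) => //= h3; try lia.
by clear h1 h2 h3; rewrite -leNgt => h1 h2; lra.
Qed.

Lemma pos_lt_irr s a : ~~ pos_lt s a a.
Proof. by rewrite /pos_lt /= ltnn ltxx andbF. Qed.

Lemma beval_PosLt s p q : beval s (PosLt p q) = pos_lt s (ieval s p) (ieval s q).
Proof. by rewrite /PosLt !bevalE. Qed.

Lemma pos_lt_same c s s' : same c s s' ->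
  aKey \notin iwrites c -> aOrd \notin iwrites c -> aY \notin rwrites c ->
  pos_lt s' = pos_lt s.
Proof. by move=> [h1 h2] ? ? ?; rewrite /pos_lt !h1 // !h2. Qed.

(** The tops increase with the level, so those below [p] form an initial segment of the levels,
    whose length is found by bisection. *)
Lemma runs_search s n p : imem s vI 0%N = p -> (imem s vLen 0%N <= n)%N ->
  (forall j k, (0 < j)%N -> (j < k <= imem s vLen 0)%N ->
     pos_lt s (imem s aTop j) (imem s aTop k)) ->
  runs Search s (100 * clog n)%N (fun s' => let lo := imem s' vLo 0%N in
    [/\ (lo <= imem s vLen 0)%N,
        forall k, (0 < k <= lo)%N -> pos_lt s (imem s aTop k) p &
        forall k, (lo < k <= imem s vLen 0)%N -> ~~ pos_lt s (imem s aTop k) p]).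
Proof.
move=> hp hn hT; set L := imem s vLen 0%N in hn hT *.
apply: (@runs_le _ (cost (Assign vLo (INum 0)) + (cost (Assign vHi (Var vLen)) +
  (clog n * (cost SearchStep + bcost (BILt (Var vLo) (Var vHi))).+1
    + (bcost (BILt (Var vLo) (Var vHi))).+1)))%N); last first.
  by rewrite [cost _]/= [cost (Assign _ _)]/= [cost SearchStep]/= [bcost _]/=;
   have : (1 < clog n)%N by []; nia.
do 2!(apply: runs_sem_seq => //).
set s1 := sem _ _.
pose I m (s' : state R) := let lo := imem s' vLo 0%N in let hi := imem s' vHi 0%N in
  [/\ (lo <= hi <= L)%N, (hi - lo < 2 ^ m)%N,
      forall k, (0 < k <= lo)%N -> pos_lt s (imem s aTop k) p &
      forall k, (hi < k <= L)%N -> ~~ pos_lt s (imem s aTop k) p].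
apply: (@runs_while _ _ _ _ _ I) => [m s' ss [h1 h2 h3 h4] hb|m s' ss [h1 h2 h3 h4] hb|].
- rewrite beval_lt [ieval _ _]/= [ieval _ _]/= in hb.
  split; first by case: m h2 => //; rewrite expn0; lia.
  apply: runs_sem => //.
  set lo := imem s' vLo 0%N in h1 h2 h3 hb.
  set hi := imem s' vHi 0%N in h1 h2 h4 hb.
  pose s2 := sem (Assign vMid (IHalf (IAdd (Var vLo) (Var vHi)))) s'.
  have -> : sem SearchStep s' = if beval s2 (PosLt (IGet aTop (IAdd (Var vMid) (INum 1))) (Var vI))
    then iupd s2 vLo 0 (imem s2 vMid 0%N + 1) else iupd s2 vHi 0 (imem s2 vMid 0%N) by [].
  have eT : imem s2 aTop = imem s aTop by rewrite /s2 /= upd_other // ss.1.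
  have eI : imem s2 vI 0%N = p by rewrite /s2 /= /upd /= ss.1.
  have eM : imem s2 vMid 0%N = (lo + hi)./2 by [].
  have eL : pos_lt s2 = pos_lt s.
    by rewrite [LHS](_ : _ = pos_lt s') // (pos_lt_same ss).
  rewrite beval_PosLt eL.
  have -> : ieval s2 (IGet aTop (IAdd (Var vMid) (INum 1))) = imem s aTop (lo + hi)./2.+1.
    by rewrite -(addn1 (lo + hi)./2) -eM -eT.
  have -> : ieval s2 (Var vI) = p by rewrite -eI.
  rewrite eM addn1.
  have hm : (hi < 2 ^ m.-1.+1 + lo)%N.
    by case: m h2 => [|m]; rewrite ?expn0 /=; lia.
  rewrite expnS in hm.
  case: ifP => hc; rewrite /I /= /upd /= -/lo -/hi; split=> //; try lia.
  + move=> k hk; case: (eqVneq k (lo + hi)./2.+1) => [->//|hne].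
    by apply: pos_lt_trans hc; apply: hT; lia.
  + move=> k hk; apply: contraFN hc => h.
    case: (eqVneq k (lo + hi)./2.+1) => [<-//|hne].
    by apply: pos_lt_trans h; apply: hT; lia.
- rewrite beval_lt [ieval _ _]/= [ieval _ _]/= in hb.
  split=> //; first by lia.
  by move=> k hk; apply: h4; lia.
- rewrite /I /s1 /= /upd /= -/L; split; [lia| |by case|lia].
  by have := clog_ltn n; lia.
Qed.

(* lev q is the size of a longest chain ending at q, pr q the element before q
   in such a chain, and tl k the last of the current elements of level k. *)
Definition levels (lt : rel nat) p len (tl pr lev : nat -> nat) : Prop :=
  [/\ (len <= p)%N,
      forall j k, (0 < j)%N -> (j < k <= len)%N -> lt (tl j) (tl k),
      forall k, (0 < k <= len)%N -> (tl k < p)%N /\ lev (tl k) = k,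
      forall q, (q < p)%N -> [/\ (0 < lev q <= len)%N, ~~ lt q (tl (lev q)) &
        (1 < lev q)%N -> [/\ (pr q < q)%N, lev (pr q) = (lev q).-1 & lt (pr q) q]] &
      forall q r, (q < r < p)%N -> lt q r -> (lev q < lev r)%N].

(** The new element extends the top of level [lo] and replaces that of level [lo + 1], which is not
    below it, so the tops stay increasing. An earlier [q] of higher level than [lo] cannot be below
    [p]: it is not below the top of its level, so that top would be below [p] too. *)
Lemma levels_step (lt : rel nat) p len tl pr lev lo :
  (forall a b c, lt a b -> lt b c -> lt a c) ->
  (forall a b c, ~~ lt a b -> lt a c -> lt b c) -> (forall a, ~~ lt a a) ->
  levels lt p len tl pr lev -> (lo <= len)%N ->
  (forall k, (0 < k <= lo)%N -> lt (tl k) p) ->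
  (forall k, (lo < k <= len)%N -> ~~ lt (tl k) p) ->
  levels lt p.+1 (if (len <= lo)%N then lo.+1 else len)
    (fun k => if k == lo.+1 then p else tl k)
    (fun q => if q == p then tl lo else pr q)
    (fun q => if q == p then lo.+1 else lev q).
Proof.
move=> tr ntr irr [h1 h2 h3 h4 h5] hlo hl hr.
set len' := if _ then _ else _.
have hlen' : (lo < len')%N /\ (len <= len')%N by rewrite /len'; case: ifP; lia.
have hlen2 k : (k <= len')%N -> k = lo.+1 \/ (k <= len)%N.
  by rewrite /len'; case: ifP; lia.
split.
- by rewrite /len'; case: ifP; lia.
- move=> j k j0 hjk; case: eqP => ej; case: eqP => ek; try lia.
  + have [||hk] := hlen2 k; [lia|lia|].
    have hn : ~~ lt (tl lo.+1) p by apply: hr; lia.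
    by apply: (ntr (tl lo.+1)) => //; apply: h2; lia.
  + by apply: hl; lia.
  + by have [||hk] := hlen2 k; [lia|lia|apply: h2; lia].
- move=> k hk; case: eqP => ek; first by rewrite eqxx; split; [lia|].
  have [||hk'] := hlen2 k; [lia|lia|].
  have [|g1 g2] := h3 k; first lia.
  by split; [lia|case: eqP => e //; lia].
- move=> q hq; case: (eqVneq q p) => e.
    rewrite eqxx; split; [lia|by rewrite e|move=> lo1].
    have [|g1 g2] := h3 lo; first lia.
    rewrite (_ : (tl lo == p) = false); last lia.
    by split; [lia|by []|rewrite e; apply: hl; lia].
  have hqp : (q < p)%N by lia.
  have [g1 g2 g3] := h4 q hqp; split; first lia.
    case: eqP => el //.
    apply/negP => hlt; have [|gg _] := h3 lo.+1; first lia.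
    have : ~~ lt (tl lo.+1) p by apply: hr; lia.
    by move=> /negP; apply; apply: ntr hlt; rewrite -el.
  move=> /g3[k1 k2 k3]; split=> //.
  by rewrite (_ : (pr q == p) = false); last lia.
- move=> q r hqr hlt; rewrite (_ : (q == p) = false); last lia.
  case: eqP => e; last by apply: h5 => //; lia.
  have hqp : (q < p)%N by lia.
  have [g1 g2 g3] := h4 q hqp.
  rewrite ltnS leqNgt; apply/negP => hlev.
  have : ~~ lt (tl (lev q)) p by apply: hr; lia.
  by move=> /negP; apply; apply: ntr g2 _; rewrite -e.
Qed.


(** Maximality is given by a certificate: a level in [1..len] for each position, strictly increasing
    along every chain, so that no chain exceeds [len] elements. The chain itself is indexed from
    1. *)
Definition longest_chain n (lt : rel nat) len (ch : nat -> nat) : Prop :=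
  [/\ forall k, (0 < k <= len)%N -> (ch k < n)%N,
      forall j k, (0 < j)%N -> (j < k <= len)%N -> (ch j < ch k)%N /\ lt (ch j) (ch k) &
      exists lev : nat -> nat, (forall q, (q < n)%N -> (0 < lev q <= len)%N) /\
        forall q r, (q < r < n)%N -> lt q r -> (lev q < lev r)%N].

(** Starting at the top of level [len], each predecessor is earlier, smaller and exactly one level
    lower, so the cells [len] down to 1 get filled. *)
Lemma runs_backtrack s n (lt : rel nat) lev :
  (forall a b c, lt a b -> lt b c -> lt a c) ->
  levels lt n (imem s vLen 0%N) (imem s aTop) (imem s aPred) lev ->
  runs Backtrack s (100 * n.+1)%N
    (fun s' => longest_chain n lt (imem s' vLen 0%N) (imem s' aChain)).
Proof.
move=> tr [h1 h2 h3 h4 h5].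
set len := imem s vLen 0%N in h1 h2 h3 h4 *.
apply: (@runs_le _ (cost (Assign vK (Var vLen)) +
  (cost (Assign vJ (IGet aTop (Var vLen))) + (len * (cost BackStep +
    bcost (BILe (INum 1) (Var vK))).+1 + (bcost (BILe (INum 1) (Var vK))).+1)))%N);
  last by rewrite /=; lia.
do 2!(apply: runs_sem_seq => //).
set s1 := sem _ _.
pose I m (s' : state R) := let ch := imem s' aChain in let j := imem s' vJ 0%N in
  [/\ imem s' vK 0%N = m, (m <= len)%N,
   (0 < m)%N -> [/\ (j < n)%N, lev j = m &
      (m < len)%N -> (j < ch m.+1)%N /\ lt j (ch m.+1)],
   forall k, (m < k <= len)%N -> (ch k < n)%N &
   forall k, (m < k)%N -> (k < len)%N -> (ch k < ch k.+1)%N /\ lt (ch k) (ch k.+1)].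
apply: (@runs_while _ _ _ _ _ I) => [m s' ss [i1 i2 i3 i4 i5] hb|m s' ss [i1 i2 i3 i4 i5] hb|].
- have m0 : (0 < m)%N by move: hb; rewrite /= i1.
  split=> //; apply: runs_sem => //.
  have [j1 j2 j3] := i3 m0.
  have eP : imem s' aPred = imem s aPred by rewrite ss.1.
  set j := imem s' vJ 0%N in j1 j2 j3.
  set ch := imem s' aChain in j3 i4 i5.
  have -> : sem BackStep s' = (State
     (upd (upd (upd (imem s') aChain m j) vJ 0 (imem s aPred j)) vK 0 m.-1) (rmem s')).
    by rewrite -eP -subn1 -i1.
  rewrite /I /= /upd /= -/ch; split; first by [].
  + lia.
  + move=> m1; have [_ _] := h4 j j1; rewrite j2 => -[|g1 g2 g3]; first lia.
    rewrite prednK // eqxx; split=> //; lia.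
  + by move=> k hk; case: eqP => e //; apply: i4; lia.
  + move=> k hk hk2; rewrite (_ : (k.+1 == m) = false); last lia.
    case: eqP => e; first by rewrite e; apply: j3; lia.
    by apply: i5; lia.
- have m0 : m = 0%N by move: hb; rewrite /= i1; lia.
  have eL : imem s' vLen 0%N = len by rewrite ss.1.
  rewrite eL; split.
  + by move=> k hk; apply: i4; lia.
  + move=> j k j0 /andP[hjk hk].
    have hd d : (0 < d)%N -> (j + d <= len)%N ->
       (imem s' aChain j < imem s' aChain (j + d))%N /\
       lt (imem s' aChain j) (imem s' aChain (j + d)%N).
      elim: d => // d IH _ hd; rewrite addnS.
      have [||k1 k2] := i5 (j + d)%N; [lia|lia|].
      case: (posnP d) => [d0|d0]; first by move: k1 k2; rewrite d0 addn0.
      have [||k3 k4] := IH; [lia|lia|split; [lia|exact: tr k4 k2]].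
    by have := hd (k - j)%N; rewrite subnKC; [apply; lia|lia].
  + exists lev; split=> // q hq; by have [] := h4 q hq.
- rewrite /I /s1 /= /upd /= -/len; split=> //; try lia.
  + by move=> l0; have [|g1 g2] := h3 len; [lia|split=> //; lia].
Qed.

Lemma runs_longest s n : imem s aSize 0%N = n ->
  runs Longest s (600 * (n.+1 * clog n))%N
    (fun s' => longest_chain n (pos_lt s) (imem s' vLen 0%N) (imem s' aChain)).
Proof.
move=> hn.
apply: (@runs_le _ (cost (Assign vLen (INum 0)) +
   (for_cost n (100 * clog n + cost Insert) + 100 * n.+1))%N); last first.
  rewrite /for_cost [cost Insert]/= [cost _]/=; have : (1 < clog n)%N by [].
  by nia.
apply: runs_sem_seq => //; set s1 := sem _ _; apply: runs_seq.
pose J p (s' : state R) := exists lev,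
  levels (pos_lt s) p (imem s' vLen 0%N) (imem s' aTop) (imem s' aPred) lev.
suff H : runs (For vI (Seq Search Insert)) s1 (for_cost n (100 * clog n + cost Insert)) (J n).
  apply: (runs_conseq H) => // s' [lev hlev].
  by apply: runs_backtrack hlev => a b c; exact: pos_lt_trans.
apply: runs_for => //.
  exists (fun=> 0%N); rewrite /s1 /= /upd /=; split=> //; try lia.
move=> p s2 hp ss2 ei [lev hlev].
have [l1 l2 l3 l4 l5] := hlev.
have eL : pos_lt s2 = pos_lt s.
  by rewrite (pos_lt_same ss2) // [LHS](_ : _ = pos_lt s).
apply: runs_seq.
have HS : runs Search s2 (100 * clog n)%N (fun s' => let lo := imem s' vLo 0%N in
    [/\ (lo <= imem s2 vLen 0)%N,
        forall k, (0 < k <= lo)%N -> pos_lt s2 (imem s2 aTop k) p &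
        forall k, (lo < k <= imem s2 vLen 0)%N -> ~~ pos_lt s2 (imem s2 aTop k) p]).
  by apply: runs_search; rewrite // ?eL //; lia.
apply: (runs_conseq (runs_same HS)) => // s3 [[k1 k2 k3] ss3].
apply: runs_sem_le => //.
rewrite eL in k2 k3.
set lo := imem s3 vLo 0%N in k1 k2 k3.
have := levels_step (@pos_lt_trans s) (@pos_lt_ntrans s) (@pos_lt_irr s) hlev k1 k2 k3.
set lev' := fun q => if q == p then lo.+1 else _ => hlev'.
exists lev'; move: hlev'; congr levels.
- rewrite /= /upd /= -/lo ss3.1 // addn1.
  by case: ifP => _; rewrite /= /upd /= ?addn1 // ss3.1.
- apply/funext => k; rewrite /= /upd /= -/lo addn1.
  by case: (imem s3 _ _ <= lo)%N; rewrite /= /upd /= ?addn1 !ss3.1 // ei.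
- apply/funext => k; rewrite /= /upd /= -/lo.
  by case: (imem s3 _ _ <= lo)%N; rewrite /= /upd /= ?addn1 !ss3.1 // ei.
Qed.

End LongestCorrect.

(** * Geometry *)

Section Geometry.
Variable R : realType.
Implicit Types (l : ell R).

(** The form [0 - x] is the one the machine computes, which has subtraction but no opposite. *)
Definition flip (b : bool) (x : R) : R := if b then x else 0 - x.
Definition right_ell l : bool := xc l <= xh l.
Definition up_ell l : bool := yc l <= yv l.

(* After the reflections encoded by [orient l], [l] has its arms going right and
   up from the corner [(cx l, cy l)]. *)
Definition orient l : nat := ((if right_ell l then 0 else 1) + (if up_ell l then 0 else 2))%N.
Definition cx l : R := flip (right_ell l) (xc l).
Definition cy l : R := flip (up_ell l) (yc l).

Lemma norm_dist (a b : R) : `|b - a| = if a <= b then b - a else a - b.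
Proof.
by case: leP => h; [rewrite ger0_norm ?subr_ge0|rewrite ltr0_norm ?opprB ?subr_lt0].
Qed.

Lemma elength_gt0 l : 0 < elength l.
Proof. by rewrite /elength /hlength normr_gt0 subr_eq0 eq_sym ell_hpos. Qed.

Lemma orient_inj l1 l2 : orient l1 = orient l2 ->
  right_ell l1 = right_ell l2 /\ up_ell l1 = up_ell l2.
Proof. by rewrite /orient; do 4!case: ifP. Qed.

Lemma orient_lt4 l : (orient l < 4)%N.
Proof. by rewrite /orient; do 2!case: ifP. Qed.

Lemma points_reflected l p : equilateral l ->
  points l p <->
  (flip (up_ell l) p.2 = cy l /\
     cx l <= flip (right_ell l) p.1 <= cx l + elength l) \/
  (flip (right_ell l) p.1 = cx l /\
     cy l <= flip (up_ell l) p.2 <= cy l + elength l).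
Proof.
case: p => x y he; have hv : elength l = vlength l by [].
rewrite /points /= /cx /cy {2}hv /elength /hlength /vlength /flip /right_ell /up_ell.
rewrite !norm_dist.
by case: (leP (xc l) (xh l)) => h1; case: (leP (yc l) (yv l)) => h2;
  split; (move=> [[k1 k2]|[k1 k2]]; [left|right]; split; lra).
Qed.

Lemma meet_sym l1 l2 :
  points l1 `&` points l2 !=set0 -> points l2 `&` points l1 !=set0.
Proof. by rewrite setIC. Qed.

Section Pair.
Variables l1 l2 : ell R.
Hypotheses (e1 : equilateral l1) (e2 : equilateral l2) (sh : orient l1 = orient l2).

(** The horizontal arm of [l1] and the vertical arm of [l2] cross at the point with reflected
    coordinates [(cx l2, cy l1)]. *)
Lemma ell_meet :
  cx l1 <= cx l2 <= cx l1 + elength l1 -> cy l2 <= cy l1 <= cy l2 + elength l2 ->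
  points l1 `&` points l2 !=set0.
Proof.
have [hr hu] := orient_inj sh; move=> h1 h2.
have fK b x : flip b (flip b x) = x by rewrite /flip; case: b => //; lra.
exists (flip (right_ell l2) (cx l2), flip (up_ell l1) (cy l1)); split.
  by apply/(points_reflected _ e1); left; rewrite /= hr !fK.
by apply/(points_reflected _ e2); right; rewrite /= -hu !fK.
Qed.

Lemma ell_disjoint_nested : cx l1 < cx l2 -> cy l1 < cy l2 ->
  ~ (points l1 `&` points l2 !=set0).
Proof.
have [hr hu] := orient_inj sh; move=> h1 h2 [p []].
move=> /(points_reflected _ e1) k1 /(points_reflected _ e2); rewrite -hr -hu.
by case: k1 => -[k1 k2]; case=> -[k3 k4]; lra.
Qed.

Lemma ell_disjoint_x : cx l1 + elength l1 < cx l2 ->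
  ~ (points l1 `&` points l2 !=set0).
Proof.
have [hr hu] := orient_inj sh; have := elength_gt0 l1; move=> h0 h1 [p []].
move=> /(points_reflected _ e1) k1 /(points_reflected _ e2); rewrite -hr -hu.
by case: k1 => -[k1 k2]; case=> -[k3 k4]; lra.
Qed.

Lemma ell_disjoint_y : cy l1 + elength l1 < cy l2 ->
  ~ (points l1 `&` points l2 !=set0).
Proof.
have [hr hu] := orient_inj sh; have := elength_gt0 l1; move=> h0 h1 [p []].
move=> /(points_reflected _ e1) k1 /(points_reflected _ e2); rewrite -hr -hu.
by case: k1 => -[k1 k2]; case=> -[k3 k4]; lra.
Qed.

End Pair.
End Geometry.

(** * Separation and growth of slabs *)

Section SlabTheory.
Variable R : realType.
Variables (n : nat) (K : nat -> nat) (X W : nat -> R) (C S : nat -> nat) (cm : nat).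
Hypothesis H : slabs n K X W C S cm.

Lemma slab_key_mono c c' : (c <= c' <= cm)%N -> (K (S c) <= K (S c'))%N.
Proof.
have [_ _ h3] := H.
move=> /andP[hc hc']; rewrite -(subnKC hc); have : (c + (c' - c) <= cm)%N by lia.
elim: (c' - c)%N => [|d IH]; first by rewrite addn0.
rewrite addnS => hd; apply: leq_trans (IH _) _; first lia.
by have [] := h3 _ hd.
Qed.

(** By monotonicity all slabs between those of [i] and [j] carry the same key, hence the same width,
    and each starts at least one width after the preceding one. *)
Lemma slab_sep i j m :
  (forall a b, (a < n)%N -> (b < n)%N -> K a = K b -> W a = W b) ->
  (forall a, (a < n)%N -> 0 < W a) ->
  (i < n)%N -> (j < n)%N -> K i = K j -> (C i + m <= C j)%N ->
  X (S (C i)) + m%:R * W i <= X (S (C j)).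
Proof.
have [h1 h2 h3] := H => hW hW0 hi hj hK hm.
have [i1 i2 i3] := h1 _ hi; have [j1 j2 j3] := h1 _ hj.
have n0 : (0 < n)%N by lia.
have hKd c : (C i <= c <= C j)%N -> K (S c) = K i.
  move=> hc; apply/eqP; rewrite eqn_leq -{2}i2 slab_key_mono; last lia.
  by rewrite hK -j2 slab_key_mono //; lia.
have hd d : (C i + d <= C j)%N -> X (S (C i)) + d%:R * W i <= X (S (C i + d)%N).
  elim: d => [_|d IH hd]; first by rewrite mul0r addr0 addn0.
  have [|_ h4] := h3 (C i + d)%N; first lia.
  have e1 : K (S (C i + d)%N) = K i by apply: hKd; lia.
  have e2 : K (S (C i + d).+1) = K i by apply: hKd; lia.
  have e3 : W (S (C i + d)%N) = W i by apply: hW => //; apply: h2 => //; lia.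
  have := h4 (etrans e1 (esym e2)); rewrite e3 addnS => h5.
  have := IH ltac:(lia); rewrite -natr1; lra.
have := hd (C j - C i)%N; rewrite subnKC; last lia.
move=> /(_ (leqnn _)); apply: le_trans; rewrite lerD2l ler_pM2r ?hW0 // ler_nat.
lia.
Qed.

End SlabTheory.

(** For the cut by length, coordinate and width coincide: after a slab starting at [x], the next
    starts at [2x] or later. *)
Lemma slab_growth (R : realType) n (K : nat -> nat) (X : nat -> R) C S cm c :
  slabs n K X X C S cm -> (forall i, K i = 0%N) -> (c <= cm)%N ->
  2 ^+ c * X (S 0%N) <= X (S c).
Proof.
move=> [_ _ h3] hK; elim: c => [|c IH] hc; first by rewrite mul1r.
have [_] := h3 c hc; rewrite !hK => /(_ erefl).
have := IH (ltnW hc); rewrite exprS -mulrA; lra.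
Qed.

(** * Length ratio and logarithm *)

Section Ratio.
Variables (R : realType) (n : nat) (L : 'I_n -> ell R).

Lemma dratio_ge (i j : 'I_n) (x : R) : 0 < x -> 
  x * elength (L i) <= elength (L j) -> x <= dratio L.
Proof.
move=> x0 h; rewrite /dratio.
have hmax k : elength (L k) <= dmax L by exact: le_bigmax.
have hmin : dmin L <= elength (L i) by exact: bigmin_le.
have hmin0 : 0 < dmin L.
  rewrite /dmin; apply/bigmin_gtP; split=> [|k _]; last exact: elength_gt0.
  by apply: lt_le_trans (hmax i); exact: elength_gt0.
rewrite ler_pdivlMr //; apply: le_trans (hmax j); apply: le_trans h.
by rewrite ler_pM2l.
Qed.

(** The factor 2 inside the logarithm pays for the [+ 1], that is, for the group numbered 0. *)
Lemma log2_dratio_ge (m : nat) : 2 ^+ m <= dratio L ->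
  (m.+1)%:R <= log2 (2 * dratio L).
Proof.
move=> h; have h2 : 0 < ln (2 : R) by rewrite ln_gt0 // ltr1n.
have hp : (0 : R) < 2 ^+ m by exact: exprn_gt0.
rewrite /log2 ler_pdivlMr // (mulr_natl (ln 2) m.+1) -lnXn // ler_ln ?posrE ?exprn_gt0 //.
  by rewrite exprS ler_pM2l.
by rewrite mulr_gt0 //; exact: lt_le_trans h.
Qed.

End Ratio.

(** * Cells and classes *)

Section Cells.
Variables (R : realType) (n : nat) (L : 'I_n -> ell R).
Hypothesis Leq : forall i, equilateral (L i).
Variables (sg : nat -> nat) (px py le : nat -> R).
Hypotheses (sgE : forall i : 'I_n, sg i = orient (L i))
  (pxE : forall i : 'I_n, px i = cx (L i)) (pyE : forall i : 'I_n, py i = cy (L i))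
  (leE : forall i : 'I_n, le i = elength (L i)).
(** Here [g], [u], [v] number the groups, columns and cells. Columns are numbered across all kinds
    and cells across all columns, so [v] determines [u], and [u] determines group and shape. Both
    [kind] and [cls] pack their components in mixed radix. *)
Variables (g u v S1 S2 S3 : nat -> nat) (m1 m2 m3 : nat).
Let kind i := (4 * g i + sg i)%N.
Let width i := le (S1 (g i)).
Let cls i := (3 * (3 * kind i + u i %% 3) + v i %% 3)%N.
Hypothesis slabs1 : slabs n (fun=> 0%N) le le g S1 m1.
Hypothesis slabs2 : slabs n kind px width u S2 m2.
Hypothesis slabs3 : slabs n u py width v S3 m3.

Local Notation meet i j := (points (L i) `&` points (L j) !=set0).

Lemma width_bounds i : (i < n)%N -> width i <= le i < width i + width i.
Proof. by move=> hi; have [h _ _] := slabs1; have [] := h i hi. Qed.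

Lemma width_gt0 i : (i < n)%N -> 0 < width i.
Proof. by move=> /width_bounds; lra. Qed.

Lemma kind_inj (i j : 'I_n) : kind i = kind j -> g i = g j /\ orient (L i) = orient (L j).
Proof.
by rewrite /kind !sgE; have := orient_lt4 (L i); have := orient_lt4 (L j); lia.
Qed.

Lemma kind_width i j : (i < n)%N -> (j < n)%N -> kind i = kind j -> width i = width j.
Proof.
move=> hi hj hk; rewrite /width.
by have [-> _] := @kind_inj (Ordinal hi) (Ordinal hj) hk.
Qed.

Lemma column_kind i j : (i < n)%N -> (j < n)%N -> u i = u j -> kind i = kind j.
Proof.
have [h _ _] := slabs2; move=> hi hj huij.
by have [_ <- _] := h i hi; have [_ <- _] := h j hj; rewrite huij.
Qed.

Lemma cell_column i j : (i < n)%N -> (j < n)%N -> v i = v j -> u i = u j.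
Proof.
have [h _ _] := slabs3; move=> hi hj hvij.
by have [_ <- _] := h i hi; have [_ <- _] := h j hj; rewrite hvij.
Qed.

Lemma column_bounds i : (i < n)%N -> px (S2 (u i)) <= px i < px (S2 (u i)) + width i.
Proof.
have [h1 h2 _] := slabs2; move=> hi; have [a b c] := h1 i hi.
by rewrite -(kind_width _ _ b) //; apply: h2 => //; lia.
Qed.

Lemma cell_bounds i : (i < n)%N -> py (S3 (v i)) <= py i < py (S3 (v i)) + width i.
Proof.
have [h1 h2 _] := slabs3; move=> hi; have [a b c] := h1 i hi.
have hS : (S3 (v i) < n)%N by apply: h2 => //; lia.
by rewrite -(kind_width hS hi (column_kind hS hi b)).
Qed.

(** With [w] the width, the columns start at least [3w] apart and the corner of [i] lies less than
    [w] into its column. The gap thus exceeds [2w], which exceeds the length of [i]; this is why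
    residues modulo 3 are taken. *)
Lemma far_columns i j : (i < n)%N -> (j < n)%N -> kind i = kind j ->
  (u i + 3 <= u j)%N -> px i + le i < px j.
Proof.
move=> hi hj hk hu.
have := slab_sep slabs2 kind_width width_gt0 hi hj hk hu.
have := column_bounds hi; have := column_bounds hj; have := width_bounds hi.
lra.
Qed.

Lemma far_cells i j : (i < n)%N -> (j < n)%N -> u i = u j ->
  (v i + 3 <= v j)%N -> py i + le i < py j.
Proof.
move=> hi hj hk hv.
have hW a b (ha : (a < n)%N) (hb : (b < n)%N) (h : u a = u b) : width a = width b.
  exact: kind_width (column_kind ha hb h).
have := slab_sep slabs3 hW width_gt0 hi hj hk hv.
have := cell_bounds hi; have := cell_bounds hj; have := width_bounds hi.
lra.
Qed.

(** Distinct numbers with equal residues differ by at least 3, so the two are separated horizontally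
    if their columns differ, and otherwise vertically. *)
Lemma same_class_disjoint (i j : 'I_n) : cls i = cls j -> v i <> v j -> ~ meet i j.
Proof.
move=> hc hv.
have [hk hu3 hv3] : [/\ kind i = kind j, u i %% 3 = u j %% 3 & v i %% 3 = v j %% 3]%N.
  by move: hc; rewrite /cls; split; lia.
have [_ hs] := kind_inj hk.
have [huij|huij|huij] := ltngtP (u i) (u j).
- by apply: ell_disjoint_x => //; rewrite -!pxE -leE; apply: far_columns => //; lia.
- move=> /meet_sym; apply: ell_disjoint_x => //; rewrite -!pxE -leE.
  by apply: far_columns => //; lia.
have [hvij|hvij|//] := ltngtP (v i) (v j).
- by apply: ell_disjoint_y => //; rewrite -!pyE -leE; apply: far_cells => //; lia.
- move=> /meet_sym; apply: ell_disjoint_y => //; rewrite -!pyE -leE.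
  by apply: far_cells => //; lia.
Qed.

Lemma class_lt (i : 'I_n) : (cls i < 36 * m1.+1)%N.
Proof.
have [h _ _] := slabs1; have [hg _ _] := h i (ltn_ord i).
by rewrite /cls /kind sgE; have := orient_lt4 (L i); lia.
Qed.

Lemma groups_le_log2 : (0 < n)%N -> m1.+1%:R <= log2 (2 * dratio L).
Proof.
move=> n0; have [_ h _] := slabs1.
have h0 := h 0%N n0 (leq0n _); have hm := h m1 n0 (leqnn _).
apply: log2_dratio_ge; apply: (@dratio_ge _ _ _ (Ordinal h0) (Ordinal hm)).
  exact: exprn_gt0.
by rewrite -!leE; exact: slab_growth slabs1 _ _.
Qed.

Variables (ord ch : nat -> nat) (len : nat).
Let lt p q := (v (ord p) < v (ord q))%N ||
  ((v (ord p) == v (ord q)) && (py (ord p) < py (ord q))).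
Hypothesis sorted : sorted_by n (key_le v px py) ord.
Hypothesis chain : longest_chain n lt len ch.

Lemma alpha_le_chain : (alpha (intersection_graph L) <= len)%N.
Proof.
apply/bigmax_leqP => I hI.
have [h1 h2 h3] := sorted.
have [_ _ [lev [l1 l2]]] := chain.
have /choice[pos hpos] (i : 'I_n) : exists p, (p < n)%N /\ ord p = i.
  by have [p p1 p2] := sorted_by_surj sorted (ltn_ord i); exists p.
(* Read in sorted order, [I] is a chain, so its levels increase strictly and are distinct. *)
have lvlt i j : i \in I -> j \in I -> (pos i < pos j)%N -> (lev (pos i) < lev (pos j))%N.
  move=> iI jI hp; have [pi ei] := hpos i; have [pj ej] := hpos j.
  have hne : i != j by apply: contraTneq hp => ->; rewrite ltnn.
  have hm : ~ meet i j.
    move: hI => /forall_inP/(_ i iI)/forall_inP/(_ j jI).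
    by rewrite /intersection_graph hne /= => /asboolPn.
  apply: l2; first by lia.
  rewrite /lt ei ej.
  have := h3 _ _ (ltnW hp) pj; rewrite ei ej /key_le.
  have [//|//|hv /=] := ltngtP (v i) (v j).
  have hu := cell_column (ltn_ord i) (ltn_ord j) hv.
  have hk := column_kind (ltn_ord i) (ltn_ord j) hu.
  have hw := kind_width (ltn_ord i) (ltn_ord j) hk.
  have [_ hs] := kind_inj hk.
  have := column_bounds (ltn_ord i); have := column_bounds (ltn_ord j).
  have := cell_bounds (ltn_ord i); have := cell_bounds (ltn_ord j).
  have := width_bounds (ltn_ord i); have := width_bounds (ltn_ord j).
  rewrite hu hv hw => b1 b2 b3 b4 b5 b6 hkey.
  rewrite ltNge; apply/negP => hy; apply: hm.
  have hx : px i <= px j by move: hkey => /orP[/ltW|/andP[]].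
  by apply: ell_meet => //; rewrite -?pxE -?pyE -leE; lra.
have linj : {in I &, injective (fun i => lev (pos i))}.
  move=> i j iI jI e; have [pi ei] := hpos i; have [pj ej] := hpos j.
  have [hp|hp|hp] := ltngtP (pos i) (pos j).
  - by have := lvlt _ _ iI jI hp; rewrite e ltnn.
  - by have := lvlt _ _ jI iI hp; rewrite e ltnn.
  - by apply: val_inj; rewrite /= -ei -ej hp.
(* Levels are shifted to [0..len - 1]. The type ['I_len.+1] is there for [inord], and its last
   element is discarded when counting. *)
have /card_in_imset <- : {in I &, injective (fun i => inord (lev (pos i)).-1 : 'I_len.+1)}.
  move=> i j iI jI /(congr1 val); have [pi _] := hpos i; have [pj _] := hpos j.
  have := l1 _ pi; have := l1 _ pj => hj hi.
  by rewrite /= !inordK; [move=> e; apply: linj => //; lia|lia|lia].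
have hsub : [set inord (lev (pos i)).-1 | i in I]%SET \subset [set~ (ord_max : 'I_len.+1)]%SET.
  apply/fintype.subsetP => _ /imsetP[i iI ->]; rewrite !inE -val_eqE /= inordK.
    by have [pi _] := hpos i; have := l1 _ pi; lia.
  by have [pi _] := hpos i; have := l1 _ pi; lia.
by have := subset_leq_card hsub; rewrite cardsC1 card_ord.
Qed.

(** In a common cell the chain increases strictly in ordinate; as ties in abscissa are sorted by
    decreasing ordinate, it increases strictly in abscissa too, and the two are nested. Different
    cells are settled by the class. *)
Lemma chain_disjoint (i j : 'I_n) k k' : (0 < k)%N -> (k < k' <= len)%N ->
  ord (ch k) = i -> ord (ch k') = j -> cls i = cls j -> ~ meet i j.
Proof.
move=> k0 hkk ei ej hc.
have [h1 h2 h3] := sorted; have [c1 c2 _] := chain.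
have [hp] := c2 _ _ k0 hkk.
have := h3 _ _ (ltnW hp) (c1 k' ltac:(lia)).
rewrite /lt ei ej /key_le; have [hv|hv|hv /=] := ltngtP (v i) (v j) => //.
  by move=> _ _; apply: same_class_disjoint => //; lia.
move=> hx hy.
have hk := column_kind (ltn_ord i) (ltn_ord j) (cell_column (ltn_ord i) (ltn_ord j) hv).
have [_ hs] := kind_inj hk.
apply: ell_disjoint_nested => //; rewrite -?pxE -?pyE //.
by move: hx => /orP[//|/andP[_]]; lra.
Qed.

End Cells.

(** * The algorithm *)

Notation aOrient := 8%N (only parsing).
Notation aClass := 9%N (only parsing).
Notation aCount := 13%N (only parsing).
Notation vBest := 31%N (only parsing).
Notation vBestClass := 32%N (only parsing).
Notation vClass := 33%N (only parsing).
Notation aLength := 9%N (only parsing).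
Notation aCx := 10%N (only parsing).
Notation aCy := 11%N (only parsing).

Definition At a : iexp := IGet a (Var vI).
Definition RAt a : rexp := RGet a (Var vI).

(** Coordinate and width both receive the length, so that the first partition, with all keys 0, cuts
    the lengths into doubling groups. *)
Definition Normalize : cmd :=
  Seq (If (BRLe (RAt 0) (RAt 2))
     (Seq (RSet aLength (Var vI) (RSub (RAt 2) (RAt 0)))
     (Seq (RSet aCx (Var vI) (RAt 0)) (ISet aOrient (Var vI) (INum 0))))
     (Seq (RSet aLength (Var vI) (RSub (RAt 0) (RAt 2)))
     (Seq (RSet aCx (Var vI) (RSub (RNum 0) (RAt 0))) (ISet aOrient (Var vI) (INum 1)))))
 (Seq (If (BRLe (RAt 1) (RAt 5))
     (RSet aCy (Var vI) (RAt 1))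
     (Seq (RSet aCy (Var vI) (RSub (RNum 0) (RAt 1)))
          (ISet aOrient (Var vI) (IAdd (At aOrient) (INum 2)))))
 (Seq (RSet aX (Var vI) (RAt aLength)) (RSet aW (Var vI) (RAt aLength)))).

(** The key is [4 * group + shape], formed by additions; the column width is the length at which the
    group starts. *)
Definition ByColumn : cmd :=
  Seq (ISet aKey (Var vI) (IAdd (IAdd (IAdd (At aC) (At aC)) (IAdd (At aC) (At aC))) (At aOrient)))
 (Seq (RSet aX (Var vI) (RAt aCx)) (RSet aW (Var vI) (RGet aLength (IGet aS (At aC))))).

(** The old key enters the class before the column number overwrites it. [aW] is kept, so cells are
    as high as columns are wide. *)
Definition ByRow : cmd :=
  Seq (ISet aClass (Var vI) (IAdd (IAdd (IAdd (At aKey) (At aKey)) (At aKey)) (At aRes)))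
 (Seq (ISet aKey (Var vI) (At aC)) (RSet aX (Var vI) (RAt aCy))).

Definition ByCell : cmd :=
  Seq (ISet aClass (Var vI) (IAdd (IAdd (IAdd (At aClass) (At aClass)) (At aClass)) (At aRes)))
 (Seq (ISet aKey (Var vI) (At aC))
 (Seq (RSet aX (Var vI) (RAt aCx)) (RSet aY (Var vI) (RAt aCy)))).

Definition Partition : cmd := Seq Sort Scan.

Definition Elem : iexp := IGet aOrd (IGet aChain (IAdd (Var vI) (INum 1))).

Definition CountStep : cmd :=
  If (BILt (Var vI) (Var vLen))
    (Seq (Assign vClass (IGet aClass Elem))
    (Seq (ISet aCount (Var vClass) (IAdd (IGet aCount (Var vClass)) (INum 1)))
         (If (BILt (Var vBest) (IGet aCount (Var vClass)))
             (Seq (Assign vBest (IGet aCount (Var vClass))) (Assign vBestClass (Var vClass)))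
             Skip)))
    Skip.

Definition MarkStep : cmd :=
  If (BAnd (BILt (Var vI) (Var vLen)) (BIEq (IGet aClass Elem) (Var vBestClass)))
     (ISet aOut Elem (INum 1)) Skip.

Definition Select : cmd :=
  Seq (Assign vBest (INum 0)) (Seq (For vI CountStep) (For vI MarkStep)).

Definition Algorithm : cmd :=
  Seq (For vI Normalize) (Seq Partition
 (Seq (For vI ByColumn) (Seq Partition
 (Seq (For vI ByRow) (Seq Partition
 (Seq (For vI ByCell) (Seq Sort (Seq Longest Select)))))))).

(** * Correctness and cost of the single passes *)

Section AlgorithmCorrect.
Variable R : realType.
Implicit Types (s : state R).

Lemma runs_normalize s n : imem s aSize 0%N = n ->
  runs (For vI Normalize) s (200 * (n.+1 * clog n))%N (fun s' =>
   forall i, (i < n)%N ->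
   let h := rmem s 0%N i <= rmem s 2%N i in let w := rmem s 1%N i <= rmem s 5%N i in
   [/\ rmem s' aLength i = (if h then rmem s 2%N i - rmem s 0%N i else rmem s 0%N i - rmem s 2%N i),
    rmem s' aCx i = flip h (rmem s 0%N i) /\ rmem s' aCy i = flip w (rmem s 1%N i),
    imem s' aOrient i = ((if h then 0 else 1) + (if w then 0 else 2))%N,
    rmem s' aX i = rmem s' aLength i & rmem s' aW i = rmem s' aLength i]).
Proof.
move=> hn; apply: (@runs_le _ (for_cost n 100)); last first.
  by rewrite /for_cost; have : (1 < clog n)%N by []; nia.
pose J p (s' : state R) := forall i, (i < p)%N ->
   let h := rmem s 0%N i <= rmem s 2%N i in let w := rmem s 1%N i <= rmem s 5%N i in
   [/\ rmem s' aLength i = (if h then rmem s 2%N i - rmem s 0%N i else rmem s 0%N i - rmem s 2%N i),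
    rmem s' aCx i = flip h (rmem s 0%N i) /\ rmem s' aCy i = flip w (rmem s 1%N i),
    imem s' aOrient i = ((if h then 0 else 1) + (if w then 0 else 2))%N,
    rmem s' aX i = rmem s' aLength i & rmem s' aW i = rmem s' aLength i].
apply: (@runs_for _ _ _ _ _ n J) => // p s2 hp ss2 ei hJ.
apply: runs_sem_le => // i; rewrite ltnS => hi.
have [r0 [r1 [r2 r5]]] : rmem s2 0%N = rmem s 0%N /\ rmem s2 1%N = rmem s 1%N /\
  rmem s2 2%N = rmem s 2%N /\ rmem s2 5%N = rmem s 5%N by rewrite !ss2.2.
case: (eqVneq i p) => [->|hne].
  rewrite /= /upd /= r0 r2 ei; case: (rmem s 0%N p <= rmem s 2%N p);
  rewrite /= /upd /= r1 r5 ?ei; case: (rmem s 1%N p <= rmem s 5%N p);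
  by rewrite /= /upd /= ?r0 ?r1 ?r2 ?ei ?eqxx.
have := hJ i; rewrite (_ : (i < p)%N); last by rewrite ltn_neqAle hne.
move=> /(_ isT).
rewrite /= /upd /= r0 r2 ei; case: (rmem s2 0%N p <= rmem s2 2%N p);
case: (rmem s 0%N p <= rmem s 2%N p);
  rewrite /= /upd /= ?ei; case: (rmem s2 1%N p <= rmem s2 5%N p);
  by rewrite /= /upd /= ?ei ?(negbTE hne).
Qed.

Lemma runs_by_column s n : imem s aSize 0%N = n ->
  runs (For vI ByColumn) s (200 * (n.+1 * clog n))%N (fun s' =>
   forall i, (i < n)%N ->
   [/\ imem s' aKey i = (4 * imem s aC i + imem s aOrient i)%N,
    rmem s' aX i = rmem s aCx i & rmem s' aW i = rmem s aLength (imem s aS (imem s aC i))]).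
Proof.
move=> hn; apply: (@runs_le _ (for_cost n 100)); last first.
  by rewrite /for_cost; have : (1 < clog n)%N by []; nia.
pose J p (s' : state R) := forall i, (i < p)%N ->
   [/\ imem s' aKey i = (4 * imem s aC i + imem s aOrient i)%N,
    rmem s' aX i = rmem s aCx i & rmem s' aW i = rmem s aLength (imem s aS (imem s aC i))].
apply: (@runs_for _ _ _ _ _ n J) => // p s2 hp ss2 ei hJ.
apply: runs_sem_le => // i; rewrite ltnS leq_eqVlt => /orP[/eqP->|hi].
  rewrite /= /upd /= ei !eqxx !ss2.1 // !ss2.2 //; split=> //; lia.
have := hJ i hi; rewrite /= /upd /= ei (_ : (i == p) = false) //; lia.
Qed.

Lemma runs_by_row s n : imem s aSize 0%N = n ->
  runs (For vI ByRow) s (200 * (n.+1 * clog n))%N (fun s' =>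
   forall i, (i < n)%N ->
   [/\ imem s' aClass i = (3 * imem s aKey i + imem s aRes i)%N,
    imem s' aKey i = imem s aC i & rmem s' aX i = rmem s aCy i]).
Proof.
move=> hn; apply: (@runs_le _ (for_cost n 100)); last first.
  by rewrite /for_cost; have : (1 < clog n)%N by []; nia.
(* The pass reads and overwrites [aKey] in place, so the invariant also records that the entries
   ahead are still the old ones. *)
pose J p (s' : state R) := (forall i, (p <= i)%N -> imem s' aKey i = imem s aKey i) /\
  forall i, (i < p)%N ->
   [/\ imem s' aClass i = (3 * imem s aKey i + imem s aRes i)%N,
    imem s' aKey i = imem s aC i & rmem s' aX i = rmem s aCy i].
suff H : runs (For vI ByRow) s (for_cost n 100) (J n) by apply: (runs_conseq H) => // s' [].
apply: runs_for => // p s2 hp ss2 ei [hJ1 hJ2].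
apply: runs_sem_le => //; split=> [i hi|i].
  by rewrite /= /upd /= ei (_ : (i == p) = false); [apply: hJ1; lia|lia].
rewrite ltnS leq_eqVlt => /orP[/eqP->|hi].
  have [eC eR eY] : [/\ imem s2 aC = imem s aC, imem s2 aRes = imem s aRes
    & rmem s2 aCy = rmem s aCy] by rewrite !ss2.1 // !ss2.2.
  by rewrite /= /upd /= ei !eqxx hJ1 // eC eR eY; split=> //; lia.
have := hJ2 i hi; rewrite /= /upd /= ei (_ : (i == p) = false) //; lia.
Qed.

Lemma runs_by_cell s n : imem s aSize 0%N = n ->
  runs (For vI ByCell) s (200 * (n.+1 * clog n))%N (fun s' =>
   forall i, (i < n)%N ->
   [/\ imem s' aClass i = (3 * imem s aClass i + imem s aRes i)%N,
    imem s' aKey i = imem s aC i, rmem s' aX i = rmem s aCx i &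
    rmem s' aY i = rmem s aCy i]).
Proof.
move=> hn; apply: (@runs_le _ (for_cost n 100)); last first.
  by rewrite /for_cost; have : (1 < clog n)%N by []; nia.
pose J p (s' : state R) := (forall i, (p <= i)%N -> imem s' aClass i = imem s aClass i) /\
  forall i, (i < p)%N ->
   [/\ imem s' aClass i = (3 * imem s aClass i + imem s aRes i)%N,
    imem s' aKey i = imem s aC i, rmem s' aX i = rmem s aCx i &
    rmem s' aY i = rmem s aCy i].
suff H : runs (For vI ByCell) s (for_cost n 100) (J n) by apply: (runs_conseq H) => // s' [].
apply: runs_for => // p s2 hp ss2 ei [hJ1 hJ2].
apply: runs_sem_le => //; split=> [i hi|i].
  by rewrite /= /upd /= ei (_ : (i == p) = false); [apply: hJ1; lia|lia].
rewrite ltnS leq_eqVlt => /orP[/eqP->|hi].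
  have [eC eR eX eY] : [/\ imem s2 aC = imem s aC, imem s2 aRes = imem s aRes,
    rmem s2 aCx = rmem s aCx & rmem s2 aCy = rmem s aCy] by rewrite !ss2.1 // !ss2.2.
  by rewrite /= /upd /= ei !eqxx hJ1 // eC eR eX eY; split=> //; lia.
have := hJ2 i hi; rewrite /= /upd /= ei (_ : (i == p) = false) //; lia.
Qed.

Lemma runs_partition s n : imem s aSize 0%N = n ->
  (forall i, (i < n)%N -> 0 < rmem s aW i) ->
  runs Partition s (1000 * (n.+1 * clog n))%N (scan_post n s).
Proof.
move=> hn hW.
apply: (@runs_le _ (600 * (n.+1 * clog n) + 400 * n.+1)%N); last first.
  by have : (1 < clog n)%N by []; nia.
apply: runs_seq; apply: (runs_conseq (runs_same (runs_sort hn))) => // s1 [h1 ss1].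
have eK : imem s1 aKey = imem s aKey by rewrite ss1.1.
have eX : rmem s1 aX = rmem s aX by rewrite ss1.2.
have eY : rmem s1 aY = rmem s aY by rewrite ss1.2.
have eW : rmem s1 aW = rmem s aW by rewrite ss1.2.
have H : runs Scan s1 (400 * n.+1) (scan_post n s1).
  apply: runs_scan; [by rewrite ss1.1| |by rewrite eW].
  by rewrite /keyrel eK eX eY.
by apply: (runs_conseq H) => // s2; rewrite /scan_post eK eX eW.
Qed.

(** Both loops run up to [n] and skip indices past the chain; [len <= n] guarantees that the whole
    chain is visited. *)
Lemma runs_select s n (e cls : nat -> nat) len : imem s aSize 0%N = n ->
  imem s vLen 0%N = len -> (len <= n)%N ->
  (forall k, imem s aOrd (imem s aChain k.+1) = e k) ->
  imem s aClass = cls ->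
  (forall c, imem s aCount c = 0%N) -> (forall i, imem s aOut i = 0%N) ->
  runs Select s (500 * (n.+1 * clog n))%N (fun s' => exists bc,
    (forall c, count (fun k => cls (e k) == c) (iota 0 len) <=
               count (fun k => cls (e k) == bc) (iota 0 len))%N /\
    forall x, imem s' aOut x != 0%N <->
       exists2 k, (k < len)%N & e k = x /\ cls x = bc).
Proof.
move=> hn hlen hle he hcls hcnt hout.
apply: (@runs_le _ (cost (Assign vBest (INum 0)) + (for_cost n 100 + for_cost n 100))%N);
  last first.
  by rewrite /for_cost [cost _]/=; have : (1 < clog n)%N by []; nia.
apply: runs_sem_seq => //; set s1 := sem _ _; apply: runs_seq.
pose cc i c := count (fun k => cls (e k) == c) (iota 0 (minn i len)).
(* Initially all counts are 0, so whatever [vBestClass] holds is a most frequent class. *)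
pose J i (s' : state R) := [/\ forall c, imem s' aCount c = cc i c,
  imem s' vBest 0%N = cc i (imem s' vBestClass 0%N) &
  forall c, (cc i c <= imem s' vBest 0%N)%N].
have H : runs (For vI CountStep) s1 (for_cost n 100) (J n).
  apply: runs_for => //.
    by rewrite /J /cc /s1 min0n /= /upd /=; split.
  move=> i s2 hi ss2 ei [j1 j2 j3].
  have eL : imem s2 vLen 0%N = len by rewrite ss2.1.
  have eE : imem s2 aOrd (imem s2 aChain i.+1) = e i by rewrite !ss2.1 // -he.
  have eC : imem s2 aClass = cls by rewrite ss2.1.
  apply: runs_sem_le => //.
  rewrite /CountStep [sem _ _]/= -ltnNge ei eL addn1.
  case: ifPn => hil; last first.
    have e1 c : cc i.+1 c = cc i c.
      by rewrite /cc (_ : minn i.+1 len = minn i len) //; lia.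
    rewrite /J [imem _ vBestClass _]/= [imem _ vBest _]/= /= /upd /= e1.
    by split=> // c; rewrite e1.
  have e1 c : cc i.+1 c = (cc i c + (cls (e i) == c))%N.
    rewrite /cc (_ : minn i.+1 len = minn i len + 1)%N; last lia.
    by rewrite iotaD count_cat /= addn0 (_ : minn i len = i); last lia.
  rewrite -ltnNge eE eC.
  set c0 := cls (e i).
  rewrite /upd /= !eqxx /= j1 addn1; case: ifPn => hb; rewrite /J /= /upd /= ?eqxx.
  + split.
    * move=> c; rewrite e1; case: (eqVneq c c0) => [->|hne]; first by rewrite addn1.
      by rewrite j1 addn0.
    * by rewrite e1 eqxx addn1.
    * move=> c; rewrite e1; have := j3 c; rewrite -/c0; case: (eqVneq c0 c) => [<-|_] /=; lia.
  + split.
    * move=> c; rewrite e1; case: (eqVneq c c0) => [->|hne]; first by rewrite addn1.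
      by rewrite j1 addn0.
    * rewrite e1 j2; case: eqP => [eb|_]; last by rewrite addn0.
      by move: hb; rewrite j2 -eb -/c0 ltnSn.
    * move=> c; rewrite e1; have := j3 c; rewrite -/c0; case: (eqVneq c0 c) => [<-|_] /=; lia.
apply: (runs_conseq (runs_same H)) => // s2 [[j1 j2 j3] ss2].
set bc := imem s2 vBestClass 0%N in j2.
have ccn c : cc n c = count (fun k => cls (e k) == c) (iota 0 len).
  by rewrite /cc (minn_idPr hle).
pose M i (s' : state R) := forall x, imem s' aOut x != 0%N <->
  exists2 k, (k < minn i len)%N & e k = x /\ cls x = bc.
have H2 : runs (For vI MarkStep) s2 (for_cost n 100) (M n).
  apply: runs_for => //; first by rewrite ss2.1.
    move=> x; rewrite min0n; have -> : imem (iupd s2 vI 0 0) aOut x = 0%N.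
      by rewrite [LHS](_ : _ = imem s2 aOut x) // ss2.1 //; exact: hout.
    by split=> // -[].
  move=> i s3 hi ss3 ei hM.
  have eL : imem s3 vLen 0%N = len by rewrite ss3.1 // ss2.1.
  have eE : imem s3 aOrd (imem s3 aChain i.+1) = e i by rewrite !ss3.1 // !ss2.1 // -he.
  have eC : imem s3 aClass = cls by rewrite ss3.1 // ss2.1.
  have eB : imem s3 vBestClass 0%N = bc by rewrite ss3.1.
  apply: runs_sem_le => // x.
  rewrite /MarkStep [sem _ _]/= -ltnNge ei eL addn1 -eqn_leq eE eC eB.
  case: ifPn => [/andP[hil /eqP hc]|hn'].
    rewrite /= /upd /=; case: (eqVneq x (e i)) => [->|hx].
      by split=> // _; exists i; [lia|].
    rewrite hM; split=> -[k hk hkx]; exists k => //; first lia.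
    have hki : k <> i by move=> ki; case: hkx; rewrite ki => ex; rewrite ex eqxx in hx.
    lia.
  rewrite [imem _ _ _]/= /upd /= hM; split=> -[k hk hkx]; exists k => //; first lia.
  case: (eqVneq k i) => [ki|]; last by lia.
  move: hn'; rewrite negb_and; case: hkx; rewrite ki => -> ->; rewrite eqxx; lia.
apply: (runs_conseq H2) => // s3 hM; exists bc; split=> [c|x].
  by rewrite -!ccn -j2.
by rewrite hM (minn_idPr hle).
Qed.

End AlgorithmCorrect.

(** * Correctness *)

(** The loops control the arrays only below [n]. This suffices because slab starts are themselves
    indices below [n]. *)
Lemma slabs_ext (R : realType) n K K' (X X' W W' : nat -> R) C C' S cm :
  (0 < n)%N ->
  (forall i, (i < n)%N -> [/\ K i = K' i, X i = X' i, W i = W' i & C i = C' i]) ->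
  slabs n K X W C S cm -> slabs n K' X' W' C' S cm.
Proof.
move=> n0 e [h1 h2 h3].
have hS c : (c <= cm)%N -> (S c < n)%N by move=> hc; exact: h2.
split=> [i hi|//|c hc].
  have [a b c] := h1 i hi; have [k1 k2 k3 k4] := e i hi.
  have [g1 g2 g3 g4] := e _ (hS _ a).
  by rewrite -k4 -g1 -g2 -g3 -k1 -k2.
have [a1 a2 a3 _] := e _ (hS c ltac:(lia)); have [b1 b2 b3 _] := e _ (hS c.+1 ltac:(lia)).
by rewrite -a1 -a2 -a3 -b1 -b2; exact: h3.
Qed.

Lemma longest_chain_size n lt len ch : longest_chain n lt len ch -> (len <= n)%N.
Proof.
move=> [h1 h2 _].
have hu : uniq (map ch (iota 1 len)).
  rewrite map_inj_in_uniq ?iota_uniq // => a b; rewrite !mem_iota => ha hb e.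
  have [hab|hab|//] := ltngtP a b.
    by have [||hlt _] := h2 a b; lia.
  by have [||hlt _] := h2 b a; lia.
have hs : {subset map ch (iota 1 len) <= iota 0 n}.
  by move=> x /mapP[k]; rewrite !mem_iota add0n => hk ->; apply: h1; lia.
by have := uniq_leq_size hu hs; rewrite size_map !size_iota.
Qed.

(** Pigeonhole: the size of [s] is the sum of the frequencies of the [k] classes. *)
Lemma size_le_classes (T : eqType) (f : T -> nat) k b (s : seq T) :
  (forall x, x \in s -> (f x < k)%N) ->
  (forall c, (count (fun x => f x == c) s <= b)%N) -> (size s <= k * b)%N.
Proof.
move=> hk hb; have -> : size s = \sum_(c < k) count (fun x => f x == c) s.
  elim: s hk {hb} => [|x s IH] hk; first by rewrite big1.
  rewrite /= big_split /= -IH; last by move=> y ys; apply: hk; rewrite inE ys orbT.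
  have hx : (f x < k)%N by apply: hk; rewrite inE eqxx.
  rewrite (bigD1 (Ordinal hx)) //= eqxx big1 // => i.
  by rewrite -val_eqE /= eq_sym => /negbTE ->.
apply: (@leq_trans (\sum_(c < k) b)); first exact: leq_sum.
by rewrite sum_nat_const card_ord.
Qed.

Lemma of_familyE (V : Type) (v0 : V) n (f : 'I_n -> V) (i : 'I_n) :
  of_family v0 f i = f i.
Proof. by rewrite /of_family valK. Qed.

Lemma algorithm_correct (R : realType) n (L : 'I_n -> ell R) :
  (forall i, equilateral (L i)) ->
  runs Algorithm (input L) (60 * (100 * (n.+1 * clog n)))%N (fun s =>
    independent (intersection_graph L) (output n s) /\
    (alpha (intersection_graph L))%:R / (36 * log2 (2 * dratio L))
      <= #|output n s|%:R :> R).
Proof.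
move=> Leq; set N := (n.+1 * clog n)%N; set s0 := input L.
(* One summand per pass, [5500 * N] in all. *)
apply: (@runs_le _ (200 * N + (1000 * N + (200 * N + (1000 * N + (200 * N + (1000 * N +
  (200 * N + (600 * N + (600 * N + 500 * N)))))))))%N); last lia.
have z0 : imem s0 aSize 0%N = n by [].
apply: runs_seq; apply: (runs_conseq (runs_same (runs_normalize z0))) => // s1 [H1 ss1].
have z1 : imem s1 aSize 0%N = n by rewrite ss1.1.
have lE (i : 'I_n) : rmem s1 aLength i = elength (L i).
  by have [-> _ _ _ _] := H1 i (ltn_ord i); rewrite /= !of_familyE /elength /hlength norm_dist.
have cxE (i : 'I_n) : rmem s1 aCx i = cx (L i).
  by have [_ [-> _] _ _ _] := H1 i (ltn_ord i); rewrite /= !of_familyE.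
have cyE (i : 'I_n) : rmem s1 aCy i = cy (L i).
  by have [_ [_ ->] _ _ _] := H1 i (ltn_ord i); rewrite /= !of_familyE.
have sgE (i : 'I_n) : imem s1 aOrient i = orient (L i).
  by have [_ _ -> _ _] := H1 i (ltn_ord i); rewrite /= !of_familyE.
have X1 i : (i < n)%N -> rmem s1 aX i = rmem s1 aLength i by move=> /H1[].
have W1 i : (i < n)%N -> rmem s1 aW i = rmem s1 aLength i by move=> /H1[].
have l0 i : (i < n)%N -> 0 < rmem s1 aLength i.
  by move=> hi; rewrite -[i]/(val (Ordinal hi)) lE; exact: elength_gt0.
have K1 i : imem s1 aKey i = 0%N by rewrite ss1.1.
apply: runs_seq.
have w1 i : (i < n)%N -> 0 < rmem s1 aW i by move=> hi; rewrite W1 // l0.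
apply: (runs_conseq (runs_same (runs_partition z1 w1))) => // s2 [[P1 _] ss2].
have z2 : imem s2 aSize 0%N = n by rewrite ss2.1.
apply: runs_seq; apply: (runs_conseq (runs_same (runs_by_column z2))) => // s3 [H3 ss3].
have z3 : imem s3 aSize 0%N = n by rewrite ss3.1.
have w3 i : (i < n)%N -> 0 < rmem s3 aW i.
  move=> hi; have [_ _ ->] := H3 i hi; rewrite ss2.2 //; apply: l0.
  by have [h1 h2 _] := P1; apply: h2; [lia|have [] := h1 i hi].
apply: runs_seq.
apply: (runs_conseq (runs_same (runs_partition z3 w3))) => // s4 [[P2 R2] ss4].
have z4 : imem s4 aSize 0%N = n by rewrite ss4.1.
apply: runs_seq; apply: (runs_conseq (runs_same (runs_by_row z4))) => // s5 [H5 ss5].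
have z5 : imem s5 aSize 0%N = n by rewrite ss5.1.
have w5 i : (i < n)%N -> 0 < rmem s5 aW i by move=> hi; rewrite ss5.2 // ss4.2 // w3.
apply: runs_seq.
apply: (runs_conseq (runs_same (runs_partition z5 w5))) => // s6 [[P3 R3] ss6].
have z6 : imem s6 aSize 0%N = n by rewrite ss6.1.
apply: runs_seq; apply: (runs_conseq (runs_same (runs_by_cell z6))) => // s7 [H7 ss7].
have z7 : imem s7 aSize 0%N = n by rewrite ss7.1.
apply: runs_seq; apply: (runs_conseq (runs_same (runs_sort z7))) => // s8 [H8 ss8].
have z8 : imem s8 aSize 0%N = n by rewrite ss8.1.
apply: runs_seq; apply: (runs_conseq (runs_same (runs_longest z8))) => // s9 [H9 ss9].
have z9 : imem s9 aSize 0%N = n by rewrite ss9.1.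
set len := imem s9 vLen 0%N in H9.
have len_n := longest_chain_size H9.
pose e k := imem s9 aOrd (imem s9 aChain k.+1).
have cnt0 c : imem s9 aCount c = 0%N.
  by rewrite ss9.1 // ss8.1 // ss7.1 // ss6.1 // ss5.1 // ss4.1 // ss3.1 // ss2.1 // ss1.1.
have out0 c : imem s9 aOut c = 0%N.
  by rewrite ss9.1 // ss8.1 // ss7.1 // ss6.1 // ss5.1 // ss4.1 // ss3.1 // ss2.1 // ss1.1.
have := runs_select z9 (erefl len) len_n (fun=> erefl) (erefl _) cnt0 out0.
move=> /runs_conseq; apply=> // s10 [bc [best marked]].
(* The bound on the number of groups needs an element; without one, [alpha] is 0 and so is the
   quotient. *)
have [n0|n0] := posnP n.
  have no_i : 'I_n -> False by case=> i hi; move: hi; rewrite n0.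
  split; first by apply/forall_inP => i; case: (no_i i).
  have -> : alpha (intersection_graph L) = 0%N.
    apply/eqP; rewrite -leqn0; apply/bigmax_leqP => I _.
    by apply: leq_trans (max_card (mem I)) _; rewrite card_ord; lia.
  by rewrite mul0r ler0n.
(* Each partition reuses [aC] and [aS], so groups, columns and cells are read off different
   intermediate states. *)
pose v := imem s7 aKey; pose px := rmem s7 aX; pose py := rmem s7 aY.
pose le := rmem s1 aLength; pose sg := imem s1 aOrient.
pose g := imem s2 aC; pose S1 := imem s2 aS; pose u := imem s4 aC.
have c6 : rmem s6 aCx = rmem s1 aCx.
  by rewrite ss6.2 // ss5.2 // ss4.2 // ss3.2 // ss2.2.
have c6' : rmem s6 aCy = rmem s1 aCy.
  by rewrite ss6.2 // ss5.2 // ss4.2 // ss3.2 // ss2.2.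
have pxE (i : 'I_n) : px i = cx (L i).
  by have [_ _ h _] := H7 i (ltn_ord i); rewrite /px h c6.
have pyE (i : 'I_n) : py i = cy (L i).
  by have [_ _ _ h] := H7 i (ltn_ord i); rewrite /py h c6'.
have vE i : (i < n)%N -> v i = imem s6 aC i by move=> /H7[].
have F1 : slabs n (fun=> 0%N) le le g S1 (imem s2 vC 0%N).
  by apply: slabs_ext P1 => // i hi; split=> //; [exact: X1|exact: W1].
have key3 i : (i < n)%N -> imem s3 aKey i = (4 * g i + sg i)%N.
  by move=> hi; have [-> _ _] := H3 i hi; rewrite [imem s2 aOrient]ss2.1.
have width3 i : (i < n)%N -> rmem s3 aW i = le (S1 (g i)).
  by move=> hi; have [_ _ ->] := H3 i hi; rewrite ss2.2.
have F2 : slabs n (fun i => 4 * g i + sg i)%N px (fun i => le (S1 (g i))) u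
    (imem s4 aS) (imem s4 vC 0%N).
  apply: slabs_ext P2 => // i hi; split=> //; [exact: key3| |exact: width3].
  by have [_ -> _] := H3 i hi; have [_ _ h _] := H7 i hi; rewrite /px h c6 ss2.2.
have F3 : slabs n u py (fun i => le (S1 (g i))) v (imem s6 aS) (imem s6 vC 0%N).
  apply: slabs_ext P3 => // i hi; split=> //; last by rewrite vE.
  - by have [_ -> _] := H5 i hi.
  - have [_ _ ->] := H5 i hi; have [_ _ _ h] := H7 i hi.
    by rewrite /py h c6' ss4.2 // ss3.2 // ss2.2.
  - by rewrite ss5.2 // ss4.2 // width3.
have clsE i : (i < n)%N -> imem s9 aClass i =
    (3 * (3 * (4 * g i + sg i) + u i %% 3) + v i %% 3)%N.
  move=> hi; rewrite ss9.1 // ss8.1 //; have [-> _ _ _] := H7 i hi.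
  rewrite R3 // vE // [imem s6 aClass]ss6.1 //; have [-> _ _] := H5 i hi.
  by rewrite R2 // [imem s4 aKey]ss4.1 // key3.
have ord9 : imem s9 aOrd = imem s8 aOrd by rewrite ss9.1.
have F4 : sorted_by n (key_le v px py) (imem s8 aOrd) by [].
have F5 : longest_chain n (fun p q => (v (imem s8 aOrd p) < v (imem s8 aOrd q))%N ||
  ((v (imem s8 aOrd p) == v (imem s8 aOrd q)) &&
   (py (imem s8 aOrd p) < py (imem s8 aOrd q)))) len (imem s9 aChain).
  by move: H9; rewrite /pos_lt (ss8.1 aKey) // (ss8.2 aY).
have [ch1 ch2 _] := H9.
have [or1 or2 _] := H8.
have en k : (k < len)%N -> (e k < n)%N.
  by move=> hk; rewrite /e ord9; apply: or1; apply: ch1; lia.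
have einj k k' : (k < len)%N -> (k' < len)%N -> e k = e k' -> k = k'.
  move=> hk hk'; rewrite /e ord9 => /or2 h.
  have {}h := h (ch1 k.+1 ltac:(lia)) (ch1 k'.+1 ltac:(lia)).
  have [hkk|hkk|//] := ltngtP k k'.
    by have [||hlt _] := ch2 k.+1 k'.+1; lia.
  by have [||hlt _] := ch2 k'.+1 k.+1; lia.
have apart (i j : 'I_n) k k' : (k < k' < len)%N -> e k = i -> e k' = j ->
    imem s9 aClass i = imem s9 aClass j -> ~ (points (L i) `&` points (L j) !=set0).
  move=> hk; rewrite /e ord9 => ei ej; rewrite !clsE // => hc.
  by apply: (chain_disjoint Leq sgE pxE pyE lE F1 F2 F3 F4 F5 _ _ ei ej hc); lia.
split.
  apply/forall_inP => i; rewrite inE => /(marked i)[k hk [ek ck]].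
  apply/forall_inP => j; rewrite inE => /(marked j)[k' hk' [ek' ck']].
  rewrite /intersection_graph negb_and negbK; case: eqVneq => //= hij.
  apply/asboolPn; have [hkk|hkk|hkk] := ltngtP k k'.
  - by apply: (@apart i j k k') => //; [lia|rewrite ck ck'].
  - by move=> /meet_sym; apply: (@apart j i k' k) => //; [lia|rewrite ck ck'].
  - by case/eqP: hij; apply: val_inj; rewrite /= -ek -ek' hkk.
set b := count (fun k => imem s9 aClass (e k) == bc) (iota 0 len) in best.
(* The map [e] is injective on chain positions, so the [b] positions of the best class yield
   distinct members of the output. *)
have hb : (b <= #|output n s10|)%N.
  rewrite /b -size_filter cardE -(size_map val) -(size_map e).
  apply: uniq_leq_size.
    rewrite map_inj_in_uniq ?filter_uniq ?iota_uniq // => k k'.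
    by rewrite !mem_filter !mem_iota => /andP[_ hk] /andP[_ hk']; exact: einj.
  move=> x /mapP[k]; rewrite mem_filter mem_iota => /andP[/eqP hc hk] ->.
  apply/mapP; exists (Ordinal (en k hk)) => //.
  by rewrite mem_enum inE; apply/marked; exists k.
have hlen : (len <= 36 * (imem s2 vC 0%N).+1 * b)%N.
  rewrite -[len](size_iota 0); apply: (@size_le_classes _ (fun k => imem s9 aClass (e k))) => //.
  move=> k; rewrite mem_iota => hk; rewrite clsE; last exact: en.
  exact: (class_lt sgE u v F1 (Ordinal (en k hk))).
have halpha := alpha_le_chain Leq sgE pxE pyE lE F1 F2 F3 F4 F5.
have hlog := groups_le_log2 lE F1 n0.
have hm0 : (0 : R) < (imem s2 vC 0%N).+1%:R by rewrite ltr0n.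
rewrite ler_pdivrMr; last by rewrite mulr_gt0 //; exact: lt_le_trans hlog.
(* [alpha <= len <= 36 * groups * b]; the number of groups is at most [log2 (2 * dratio L)], and [b]
   at most the size of the output. *)
apply: (@le_trans _ _ (36 * (imem s2 vC 0%N).+1 * b)%:R).
  by rewrite ler_nat; exact: leq_trans halpha hlen.
rewrite !natrM mulrC; apply: ler_pM => //; first by rewrite ler_nat.
by rewrite ler_pM2l.
Qed.

(** The cost is of order [n log n]; the second logarithm comes for free, being at least 1 for
    [n >= 2]. *)
Lemma clog_bigO (R : realType) (a : nat) :
  (fun n : nat => (a * (n.+1 * clog n))%N%:R : R^o) =O_\oo
  (fun n : nat => n%:R * log2 n%:R ^+ 2 : R^o).
Proof.
apply/eqOP; near=> k; near=> n.
have n2 : (1 < n)%N by near: n; exact: nbhs_infty_ge.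
have l2 : 0 < ln (2 : R) by rewrite ln_gt0 // ltr1n.
have hn : (0 : R) < n%:R by rewrite ltr0n; lia.
have htl : (trunc_log 2 n)%:R <= log2 n%:R :> R.
  rewrite /log2 ler_pdivlMr // (mulr_natl (ln 2) _) -lnXn // ler_ln ?posrE ?exprn_gt0 //.
  by rewrite -natrX ler_nat trunc_logP //; lia.
have hlog1 : 1 <= log2 n%:R :> R.
  by rewrite /log2 ler_pdivlMr // mul1r ler_ln ?posrE // ler_nat.
set x : R := log2 n%:R in htl hlog1 *.
have hc : (clog n)%:R <= 3 * x by rewrite /clog -addn2 natrD; lra.
have hc2 : (clog n)%:R <= 3 * x ^+ 2.
  by apply: le_trans hc _; rewrite expr2; nra.
have hn1 : n.+1%:R <= 2 * n%:R :> R by rewrite -natrM ler_nat; lia.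
rewrite normr_nat ger0_norm; last by rewrite mulr_ge0 ?sqr_ge0 // ltW.
rewrite !natrM; apply: (@le_trans _ _ (a%:R * (2 * n%:R * (3 * x ^+ 2)))).
  by rewrite ler_wpM2l // ler_pM.
(* The factor 2 comes from [n + 1 <= 2n], and 3 from the two units that [clog] adds to the
   logarithm. *)
have -> : a%:R * (2 * n%:R * (3 * x ^+ 2)) = (6 * a%:R) * (n%:R * x ^+ 2) by ring.
apply: ler_wpM2r; first by rewrite mulr_ge0 ?sqr_ge0 // ltW.
by near: k; exact: nbhs_pinfty_ge.
Unshelve. all: by end_near.
Qed.

Theorem theorem1 (R : realType) :
  exists (algo : cmd) (T : nat -> nat),
    ((fun n : nat => (T n)%:R : R^o) =O_\oo
       (fun n : nat => n%:R * log2 n%:R ^+ 2 : R^o))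
    /\
    forall (n : nat) (L : 'I_n -> ell R),
      injective L ->
      (forall i, equilateral (L i)) ->
      exists (t : nat) (s : state R),
        exec algo (input L) t s
        /\ (t <= T n)%N
        /\ independent (intersection_graph L) (output n s)
        /\ (alpha (intersection_graph L))%:R
             / (36 * log2 (2 * dratio L))
             <= #|output n s|%:R :> R.
Proof.
exists Algorithm, (fun n => 60 * (100 * (n.+1 * clog n)))%N; split.
  by under eq_fun do rewrite mulnA; exact: clog_bigO.
move=> n L _ Leq.
by have [t [s [h1 h2 [h3 h4]]]] := algorithm_correct Leq; exists t, s.
Qed.
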